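(* Let $(\Omega,\mathcal{H},\hat{E})$ be a sublinear expectation space and let $\{X_i\}_{i=1}^{\infty}$ be a sequence of $\mathbb{R}^d$-valued random variables in it satisfying the following conditions: (i) for every $i\ge 1$, $X_{i+1}$ is independent from $(X_1,\ldots,X_i)$; (ii) $\hat{E}[X_i]=\hat{E}[-X_i]=0$ for every $i\ge 1$ (componentwise); (iii) there is a constant $M>0$ such that $\hat{E}[|X_i|^3]\le M$ for all $i\ge 1$; (vi) there exists a bounded, convex and closed subset $\Theta$ of $\mathbb{S}_+(d)$ such that $$\lim_{n\to\infty}\frac1n\sum_{i=1}^n d_H(\Theta,\Theta_i)=0,$$ where $\Theta_i$ is a bounded, convex and closed subset of $\mathbb{S}_+(d)$ such that $G_i(A):=\frac12\hat{E}[\langle AX_i,X_i\rangle]=\frac12\sup_{Q\in\Theta_i}\mathrm{tr}[AQ]$ for all $A\in\mathbb{S}(d)$. Define $G(A)=\frac12\sup_{Q\in\Theta}\mathrm{tr}[AQ]$ for $A\in\mathbb{S}(d)$, and let $S_n=X_1+\cdots+X_n$. Then $\{S_n/\sqrt{n}\}_{n=1}^\infty$ converges in law to the $G$-normal distribution $N(0;\Theta)$, i.e. $$\lim_{n\to\infty}\hat{E}\left[\varphi\left(\frac{S_n}{\sqrt n}\right)\right]=\hat{E}[\varphi(X)]\quad\text{for all }\varphi\in C_{b,Lip}(\mathbb{R}^d),$$ where $X\sim N(0;\Theta)$.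
   Context: Sublinear expectation space: $\Omega$ is a set and $\mathcal{H}$ is a linear space of real functions on $\Omega$ containing the constants, closed under $X\mapsto|X|$, and such that $\varphi(X_1,\ldots,X_n)\in\mathcal{H}$ whenever $X_1,\ldots,X_n\in\mathcal{H}$ and $\varphi\in C_{l,Lip}(\mathbb{R}^n)$. Here $C_{l,Lip}(\mathbb{R}^n)$ is the space of $\varphi:\mathbb{R}^n\to\mathbb{R}$ with $|\varphi(x)-\varphi(y)|\le C(1+|x|^m+|y|^m)|x-y|$ for all $x,y$, for some $C>0$, $m\in\mathbb{N}$ depending on $\varphi$; $C_{b,Lip}(\mathbb{R}^n)$ is the space of bounded Lipschitz functions. A sublinear expectation is a functional $\hat{E}:\mathcal{H}\to\mathbb{R}$ that is monotone ($X\ge Y\Rightarrow\hat{E}[X]\ge\hat{E}[Y]$), constant preserving ($\hat{E}[c]=c$), sub-additive ($\hat{E}[X+Y]\le\hat{E}[X]+\hat{E}[Y]$) and positively homogeneous ($\hat{E}[\lambda X]=\lambda\hat{E}[X]$, $\lambda\ge0$). An $\mathbb{R}^d$-valued random variable is an element of $\mathcal{H}^d$. Independence: $Y\in\mathcal{H}^n$ is independent from $X\in\mathcal{H}^m$ if $\hat{E}[\varphi(X,Y)]=\hat{E}\big[\hat{E}[\varphi(x,Y)]|_{x=X}\big]$ for all $\varphi\in C_{l,Lip}(\mathbb{R}^{n+m})$. Random vectors $X_1,X_2$ in $\mathbb{R}^n$ (possibly on different spaces with expectations $E_1,E_2$) are identically distributed, $X_1\sim X_2$, if $E_1[\varphi(X_1)]=E_2[\varphi(X_2)]$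 for all $\varphi\in C_{b,Lip}(\mathbb{R}^n)$. An independent copy $\bar X$ of $X$ is a random vector with $\bar X\sim X$ that is independent from $X$. $\mathbb{S}(d)$ is the space of real symmetric $d\times d$ matrices, $\|A\|=\sqrt{\sum_{i,j=1}^d a_{ij}^2}$ for $A=(a_{ij})$, and $\mathbb{S}_+(d)$ is the set of positive semidefinite elements of $\mathbb{S}(d)$. Hausdorff distance: for nonempty closed $\Delta_1,\Delta_2\subset\mathbb{S}_+(d)$, $d_H(\Delta_1,\Delta_2)=\inf\{\varepsilon>0:\Delta_1\subset B_\varepsilon(\Delta_2),\ \Delta_2\subset B_\varepsilon(\Delta_1)\}$, where $B_\varepsilon(\Delta)=\{x\in\mathbb{S}_+(d): d(x,\Delta)<\varepsilon\}$, $d(x,\Delta)=\inf_{y\in\Delta}\|x-y\|$. All sets $\Theta,\Theta_i$ are nonempty. $G$-normal distribution: a $d$-dimensional random vector $X$ is $G$-normal distributed if $aX+b\bar X\sim\sqrt{a^2+b^2}\,X$ for all $a,b\ge0$, where $\bar X$ is an independent copy of $X$. The associated function is $G(A)=\hat{E}[\frac12\langle AX,X\rangle]$, $A\in\mathbb{S}(d)$; it determines the law of $X$. For a bounded, convex, closed set $\Theta\subset\mathbb{S}_+(d)$, $X\sim N(0;\Theta)$ means that $X$ is $G$-normal distributed with $\hat{E}[\frac12\langle AX,X\rangle]=\frac12\sup_{Q\in\Theta}\mathrm{tr}[AQ]$ for all $A\in\mathbb{S}(d)$. The vector $X$ may live on another sublinear expectation space, whose expectation is still denoted $\hat{E}$.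 Equivalently, $u(t,x)=\hat{E}[\varphi(x+\sqrt t X)]$ is the unique viscosity solution on $[0,\infty)\times\mathbb{R}^d$ of $\partial_tu-G(D^2u)=0$, $u|_{t=0}=\varphi$, for $\varphi\in C_{b,Lip}(\mathbb{R}^d)$. *)

(* Defs.v *)
From HB Require Import structures.
From mathcomp Require Import all_boot all_order all_algebra.
From mathcomp Require Import all_classical all_reals all_analysis.

Set Implicit Arguments.
Unset Strict Implicit.
Unset Printing Implicit Defensive.

Import Order.TTheory GRing.Theory Num.Theory.
Import numFieldNormedType.Exports.

Local Open Scope classical_set_scope.
Local Open Scope ring_scope.

(** Vectors of R^n are row vectors ['rV[R]_n]. *)

(* The Euclidean norm on R^n and the norm sqrt(sum a_ij^2) on matrices.  The
   library norm [`|A|] on matrices is the maximum norm, so it is not used for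
   quantitative notions below. *)
Definition enorm (R : realType) (m n : nat) (A : 'M[R]_(m, n)) : R :=
  Num.sqrt (\sum_i \sum_j A i j ^+ 2).

Definition C_lLip (R : realType) (n : nat) (phi : 'rV[R]_n -> R) : Prop :=
  exists C : R, 0 < C /\ exists m : nat, forall x y : 'rV[R]_n,
    `|phi x - phi y| <= C * (1 + enorm x ^+ m + enorm y ^+ m) * enorm (x - y).

Definition C_bLip (R : realType) (n : nat) (phi : 'rV[R]_n -> R) : Prop :=
  bounded_fun phi /\
  exists L : R, forall x y : 'rV[R]_n, `|phi x - phi y| <= L * enorm (x - y).

(* The functional [Esp] is total on functions [Omega -> R], but it is only
   constrained (and only meaningful) on the space [Hsp]. *)
Record sublinear_space (R : realType) := SublinearSpace {
  Omega :> Type;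
  Hsp : set (Omega -> R);
  Esp : (Omega -> R) -> R;
  Hsp_cst : forall c : R, Hsp (fun=> c);
  Hsp_add : forall X Y : Omega -> R, Hsp X -> Hsp Y -> Hsp (fun w => X w + Y w);
  Hsp_scale : forall (c : R) (X : Omega -> R), Hsp X -> Hsp (fun w => c * X w);
  Hsp_abs : forall X : Omega -> R, Hsp X -> Hsp (fun w => `|X w|);
  Hsp_comp : forall (n : nat) (X : 'I_n -> Omega -> R) (phi : 'rV[R]_n -> R),
    (forall i, Hsp (X i)) -> C_lLip phi ->
    Hsp (fun w => phi (\row_i X i w));
  Esp_mono : forall X Y : Omega -> R, Hsp X -> Hsp Y ->
    (forall w, Y w <= X w) -> Esp Y <= Esp X;
  Esp_cst : forall c : R, Esp (fun=> c) = c;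
  Esp_subadd : forall X Y : Omega -> R, Hsp X -> Hsp Y ->
    Esp (fun w => X w + Y w) <= Esp X + Esp Y;
  Esp_scale : forall (l : R) (X : Omega -> R), 0 <= l -> Hsp X ->
    Esp (fun w => l * X w) = l * Esp X
}.

Definition random_vector (R : realType) (S : sublinear_space R) (n : nat)
    (X : S -> 'rV[R]_n) : Prop :=
  forall j : 'I_n, Hsp (fun w => X w 0 j).

(* [independent_from X Y]: Y is independent from X (not a symmetric notion). *)
Definition independent_from (R : realType) (S : sublinear_space R) (m n : nat)
    (X : S -> 'rV[R]_m) (Y : S -> 'rV[R]_n) : Prop :=
  forall phi : 'rV[R]_(m + n) -> R, C_lLip phi ->
    Esp (fun w : S => phi (row_mx (X w) (Y w))) =
    Esp (fun w : S => Esp (fun w' : S => phi (row_mx (X w) (Y w')))).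

Definition same_law (R : realType) (S1 S2 : sublinear_space R) (n : nat)
    (X1 : S1 -> 'rV[R]_n) (X2 : S2 -> 'rV[R]_n) : Prop :=
  forall phi : 'rV[R]_n -> R, C_bLip phi ->
    Esp (fun w => phi (X1 w)) = Esp (fun w => phi (X2 w)).

Definition independent_copy (R : realType) (S : sublinear_space R) (n : nat)
    (X Xbar : S -> 'rV[R]_n) : Prop :=
  [/\ random_vector Xbar, same_law Xbar X & independent_from X Xbar].

(* The vector (X_0, ..., X_(k-1)) of R^(k * d). *)
Definition first_vectors (R : realType) (T : Type) (d : nat)
    (X : nat -> T -> 'rV[R]_d) (k : nat) (w : T) : 'rV[R]_(k * d) :=
  mxvec (\matrix_(i < k) X i w).

Definition symmetric_mx (R : realType) (d : nat) : set 'M[R]_d :=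
  [set A | A^T = A].

(* <A x, x> *)
Definition qform (R : realType) (d : nat) (A : 'M[R]_d) (x : 'rV[R]_d) : R :=
  \sum_i \sum_j A i j * x 0 j * x 0 i.

Definition psd_mx (R : realType) (d : nat) : set 'M[R]_d :=
  [set A | symmetric_mx A /\ forall x : 'rV[R]_d, 0 <= qform A x].

Definition dist_set (R : realType) (d : nat) (x : 'M[R]_d) (D : set 'M[R]_d) : R :=
  inf [set enorm (x - y) | y in D].

Definition nbhd_set (R : realType) (d : nat) (e : R) (D : set 'M[R]_d) :
    set 'M[R]_d :=
  [set x | psd_mx x /\ dist_set x D < e].

Definition hausdorff_dist (R : realType) (d : nat) (D1 D2 : set 'M[R]_d) : R :=
  inf [set e : R | 0 < e /\ (D1 `<=` nbhd_set e D2 /\ D2 `<=` nbhd_set e D1)].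

(* Boundedness and closedness are those of the library norm and topology on
   matrices; all norms on matrices being equivalent, the choice is immaterial. *)
Definition uncertainty_set (R : realType) (d : nat) (Theta : set 'M[R]_d) : Prop :=
  [/\ Theta `<=` @psd_mx R d, Theta !=set0, bounded_set Theta,
      convex_set Theta & closed Theta].

Definition Gfun (R : realType) (d : nat) (Theta : set 'M[R]_d) (A : 'M[R]_d) : R :=
  2^-1 * sup [set \tr (A *m Q) | Q in Theta].

(* A given space need not carry an independent copy of X (for instance the
   canonical space over R^d with X the identity need not).  As G-normality is a
   property of the law of X, the copy is looked for on some space which carries a
   vector Y with the law of X; taking Y := X covers the case where the space of X
   already has an independent copy. *)
Definition G_normal (R : realType) (S : sublinear_space R) (d : nat)
    (X : S -> 'rV[R]_d) : Prop :=
  random_vector X /\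
  exists (S' : sublinear_space R) (Y Ybar : S' -> 'rV[R]_d),
    [/\ random_vector Y, same_law Y X, independent_copy Y Ybar &
        forall a b : R, 0 <= a -> 0 <= b ->
          same_law (fun w => a *: Y w + b *: Ybar w)
                   (fun w => Num.sqrt (a ^+ 2 + b ^+ 2) *: X w)].

(* X ~ N(0; Theta) *)
Definition G_normal_law (R : realType) (S : sublinear_space R) (d : nat)
    (Theta : set 'M[R]_d) (X : S -> 'rV[R]_d) : Prop :=
  G_normal X /\
  forall A : 'M[R]_d, symmetric_mx A ->
    Esp (fun w => 2^-1 * qform A (X w)) = Gfun Theta A.

(* Main.v *)
(** A Lindeberg argument without PDE regularity.  For a random vector X the
    operator T f(x) = E[f(x + cX)] is monotone, sublinear and commutes with
    translations, so it satisfies Jensen's inequality T(Rf) <= R(Tf) for every R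
    which is an average of translations.  Take for R an iterated average over short
    segments in the coordinate directions: for an L-Lipschitz f it moves f by
    O(L eps) only, and Rf has a third-order Taylor expansion whose constants depend on
    L and eps alone.  With T_k and Q the operators of X_k and of Z for
    c = 1 / sqrt n, a Taylor expansion gives
    |T_k (Rf) - Q (Rf)| <= C (d_H(Theta, Theta_k) / n + n^(-3/2)).
    If u_k = T_k u_(k+1) is the value function of the sums, then
    R u_k >= T_k (R u_(k+1)) >= Q (R u_(k+1)) - error, so R u dominates the value
    function of Z up to the sum of the errors; exchanging the two chains gives the
    reverse inequality, so no smoothness of the solution of the G-heat equation is
    needed.  G-normality enters through Q^n phi(0) = E[phi(Z)]. *)

Require Import Defs.
From HB Require Import structures.
From mathcomp Require Import all_boot all_order all_algebra.
From mathcomp Require Import ring lra.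
From mathcomp Require Import all_classical all_reals all_analysis.

Set Implicit Arguments.
Unset Strict Implicit.
Unset Printing Implicit Defensive.

Import Order.TTheory GRing.Theory Num.Theory.
Import numFieldNormedType.Exports.

Local Open Scope classical_set_scope.
Local Open Scope ring_scope.

(** Stated for the library norm, which on row vectors is the maximum norm; the Euclidean norm enters
    only through the comparison lemmas further on. *)
Definition lip (R : realType) (V : normedModType R) (L : R) (f : V -> R) : Prop :=
  forall x y, `|f x - f y| <= L * `|x - y|.

(** * One-variable calculus: mean value bounds, derivatives from remainders, primitives *)

Section Calculus.
Variable R : realType.
Implicit Types (F G g : R -> R) (a b c k t L K s : R).

Lemma lip_continuous (V : normedModType R) L (f : V -> R) : lip L f -> continuous f.
Proof.
move=> fL x; apply/cvgrPdist_le => e e0.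
have L1 : 0 < `|L| + 1 by rewrite ltr_wpDl.
near=> y.
apply: (le_trans (fL x y)).
apply: (@le_trans _ _ ((`|L| + 1) * `|x - y|)).
  by apply: ler_wpM2r => //; apply: (le_trans (ler_norm L)); rewrite lerDl.
rewrite -ler_pdivlMl //.
near: y.
have : y @[y --> x] --> x by exact: cvg_id.
by move/cvgrPdist_le; apply; rewrite mulr_gt0 ?invr_gt0.
Unshelve. all: by end_near. Qed.

Lemma mvt_le F g (x y c B : R) : x <= y ->
  (forall r : R, x <= r <= y -> is_derive r 1 F (g r)) ->
  (forall r : R, x <= r <= y -> `|g r - c| <= B) ->
  `|F y - F x - c * (y - x)| <= B * (y - x).
Proof.
move=> xy dF gB.
have [|||r rxy ->] := @MVT_segment R F g x y.
- exact: xy.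
- by move=> r; rewrite in_itv /= => /andP[? ?]; apply: dF; lra.
- apply: derivable_within_continuous => r; rewrite in_itv /= => rxy.
  exact: (@ex_derive _ _ _ _ _ _ _ (dF r rxy)).
rewrite -mulrBl normrM (@ger0_norm _ (y - x)) ?subr_ge0 //.
by apply: ler_wpM2r; rewrite ?subr_ge0 //; apply: gB; move: rxy; rewrite in_itv.
Qed.

Lemma mvt0_le F g (s c B : R) :
  (forall r : R, `|r| <= `|s| -> is_derive r 1 F (g r)) ->
  (forall r : R, `|r| <= `|s| -> `|g r - c| <= B) ->
  `|F s - F 0 - c * s| <= B * `|s|.
Proof.
move=> dF gB; have [s0|s0] := leP 0 s.
  have := @mvt_le F g 0 s c B s0; rewrite !subr0 (ger0_norm s0).
  apply => r /andP[r0 rs].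
    by apply: dF; rewrite !ger0_norm.
  by apply: gB; rewrite !ger0_norm.
have := @mvt_le F g s 0 c B (ltW s0).
have -> : F 0 - F s - c * (0 - s) = - (F s - F 0 - c * s) by ring.
rewrite normrN (ltr0_norm s0) sub0r; apply => r /andP[r0 rs].
  by apply: dF; rewrite ler0_norm// ler0_norm ?lerN2// ltW.
by apply: gB; rewrite ler0_norm// ler0_norm ?lerN2// ltW.
Qed.

(** The difference quotient at [h] differs from [c] by at most [K] times |h|. This turns the
    remainder bounds used for directional derivatives into genuine derivatives. *)
Lemma is_derive_quadratic F (x c K : R) :
  (forall t, `|F (x + t) - F x - t * c| <= K * t ^+ 2) -> is_derive x 1 F c.
Proof.
move=> FK.
have cv : (fun h : R => h^-1 *: ((F \o shift x) (h *: 1) - F x)) @ 0^' --> c.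
  apply/cvgrPdist_le => e e0.
  near=> h.
  have h0 : h != 0 by near: h; exact: nbhs_dnbhs_neq.
  have -> : c - h^-1 *: ((F \o shift x) (h *: (1:R)) - F x)
     = - (h^-1 * (F (x + h) - F x - h * c)).
    by rewrite /= /GRing.scale /= mulr1 [h + x]addrC; field.
  rewrite normrN normrM normfV ler_pdivrMl ?normr_gt0//.
  apply: (le_trans (FK h)).
  have -> : K * h ^+ 2 = `|h| * (`|h| * K) by rewrite mulrA -expr2 real_normK ?num_real// mulrC.
  apply: ler_wpM2l => //.
  apply: (@le_trans _ _ (`|h| * (`|K| + 1))).
    by apply: ler_wpM2l => //; apply: (le_trans (ler_norm K)); rewrite lerDl.
  rewrite -ler_pdivlMr ?ltr_wpDl//.
  near: h.
  have : (h : R) @[h --> (0 : R)] --> (0 : R) by exact: cvg_id.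
  move/cvgrPdist_le => /(_ (e / (`|K| + 1))).
  rewrite divr_gt0 ?ltr_wpDl// => /(_ isT) nh.
  rewrite near_withinE; near=> h => _.
  rewrite -normrN -[- h]sub0r; near: h; exact: nh.
apply: DeriveDef; first by apply/cvg_ex; exists c.
exact: cvg_lim.
Unshelve. all: by end_near. Qed.

Lemma is_derive_affine F k a b t c : is_derive (a * t + b) 1 F c ->
  is_derive t 1 (fun r => k * F (a * r + b)) (k * (c * a)).
Proof.
move=> dF.
have dl : is_derive t 1 (fun r : R => a * r + b) a.
  apply: (@is_derive_quadratic _ _ _ 0) => h.
  by rewrite (_ : _ - _ - _ = 0) ?normr0 ?mul0r//; ring.
exact: (@is_deriveZ R R^o R^o _ k t 1 _ (@is_derive1_comp R F _ t _ _ dF dl)).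
Qed.

Lemma eq_is_derive F G t c : F =1 G -> is_derive t 1 F c -> is_derive t 1 G c.
Proof. by move=> /funext ->. Qed.

Lemma continuous_primitive g a : continuous g ->
  exists F, forall x : R, a < x -> is_derive x 1 F (g x).
Proof.
move=> cg; exists (fun x => \int[lebesgue_measure]_(t in `[a, x]) g t) => x ax.
(* Integrating up to [x + 1] makes [x] an interior point. *)
have [||||dF Fx] := @continuous_FTC1_closed R g a x (x + 1).
- lra.
- apply: continuous_compact_integrable; first exact: segment_compact.
  exact: continuous_subspaceT.
- exact: ax.
- exact: cg.
by apply: DeriveDef; [exact: dF|rewrite -derive1E; exact: Fx].
Qed.

(** With [a < 0] the primitive is differentiable on a neighbourhood of the whole segment, which
    settles continuity at both end points. *)
Lemma integral01_primitive F g a : a < 0 -> continuous g ->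
  (forall x : R, a < x -> is_derive x 1 F (g x)) ->
  \int[lebesgue_measure]_(t in `[0, 1]) g t = F 1 - F 0.
Proof.
move=> a0 cg dF; rewrite /Rintegral (@continuous_FTC2 _ g F) //.
- exact: continuous_subspaceT.
- have dF' x : a < x -> derivable F x 1 by move=> /dF [].
  have cF x : a < x -> {for x, continuous F}.
    by move=> /dF' dFx; apply: differentiable_continuous; exact/derivable1_diffP.
  split.
  + by move=> x; rewrite in_itv /= => /andP[x0 _]; apply: dF'; lra.
  + by apply: cvg_at_right_filter; apply: cF; lra.
  + by apply: cvg_at_left_filter; apply: cF; lra.
- move=> x; rewrite in_itv /= => /andP[x0 _].
  by rewrite derive1E; apply: (@derive_val _ _ _ _ _ _ _ (dF x _)); lra.
Qed.

Lemma integrable01 g : continuous g ->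
  lebesgue_measure.-integrable `[0, 1] (EFin \o g).
Proof.
move=> cg; apply: continuous_compact_integrable; first exact: segment_compact.
exact: continuous_subspaceT.
Qed.

Lemma integral01_cst c : \int[lebesgue_measure]_(t in `[0, 1]) c = c :> R.
Proof.
by rewrite Rintegral_cst//= lebesgue_measure_itv/= lte_fin ltr01 sube0 mulr1.
Qed.

End Calculus.

(** * Averages over segments *)

Section Mean.
Variables (R : realType) (V : normedModType R).
Implicit Types (f g p : V -> R) (v e x y : V) (L K B eps s : R).

Definition mean v f x : R := \int[lebesgue_measure]_(r in `[0, 1]) f (x + r *: v).

Lemma lip_line L f x v : lip L f -> lip (L * `|v|) (fun r : R => f (x + r *: v)).
Proof.
move=> fL r t; apply: (le_trans (fL _ _)).
by rewrite opprD addrACA subrr add0r -scalerBl normrZ -mulrA [`|v| * _]mulrC.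
Qed.

Lemma continuous_line L f x v : lip L f -> continuous (fun r : R => f (x + r *: v)).
Proof. by move=> /(@lip_line L f x v)/lip_continuous. Qed.

Lemma lipB L K f g : lip L f -> lip K g -> lip (L + K) (fun y => f y - g y).
Proof.
move=> fL gK x y; rewrite mulrDl; apply: le_trans (lerD (fL x y) (gK x y)).
have -> : f x - g x - (f y - g y) = (f x - f y) - (g x - g y) by ring.
exact: ler_normB.
Qed.

Lemma lip_shift L f z : lip L f -> lip L (fun y => f (y + z)).
Proof.
by move=> fL x y; apply: (le_trans (fL _ _)); rewrite opprD addrACA subrr addr0.
Qed.

Lemma meanZ L f v c x : lip L f -> mean v (fun y => c * f y) x = c * mean v f x.
Proof.
move=> fL; apply: RintegralZl => //; apply: integrable01.
exact: continuous_line fL.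
Qed.

Lemma meanB L K f g v x : lip L f -> lip K g ->
  mean v (fun y => f y - g y) x = mean v f x - mean v g x.
Proof.
by move=> fL gK; apply: RintegralB => //;
  apply: integrable01; [apply: continuous_line fL|apply: continuous_line gK].
Qed.

Lemma mean_shift f v x y : mean v f (x + y) = mean v (fun z => f (z + y)) x.
Proof. by rewrite /mean; congr Rintegral; apply/funext => r; rewrite addrAC. Qed.

Lemma mean_bound L f v c B x : lip L f ->
  (forall r : R, 0 <= r <= 1 -> `|f (x + r *: v) - c| <= B) -> `|mean v f x - c| <= B.
Proof.
move=> fL fB.
have mE (a : R) : \int[lebesgue_measure]_(t in `[(0 : R), 1]) a = a by exact: integral01_cst.
have ic (a : R) : lebesgue_measure.-integrable `[(0 : R), 1] (EFin \o (fun _ : R => a)).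
  by apply: integrable01; exact: cst_continuous.
have iF := integrable01 (@continuous_line L f x v fL).
have lo : c - B <= mean v f x.
  rewrite -[c - B]mE; apply: le_Rintegral => // r; rewrite /= in_itv /= => /fB.
  by rewrite ler_norml => /andP[]; lra.
have up : mean v f x <= c + B.
  rewrite -[c + B]mE; apply: le_Rintegral => // r; rewrite /= in_itv /= => /fB.
  by rewrite ler_norml => /andP[]; lra.
by rewrite ler_norml; apply/andP; split; lra.
Qed.

Lemma mean_mono L K f g v x : lip L f -> lip K g -> (forall y, f y <= g y) ->
  mean v f x <= mean v g x.
Proof.
move=> fL gK fg; apply: le_Rintegral => //; apply: integrable01.
  exact: continuous_line fL.
exact: continuous_line gK.
Qed.

(** Translating [g] by [y - x] brings both averages to the same base point, where the average of a
    difference is bounded by [mean_bound]. *)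
Lemma mean_sub_le L K f g v B x y : lip L f -> lip K g ->
  (forall r : R, 0 <= r <= 1 -> `|f (x + r *: v) - g (y + r *: v)| <= B) ->
  `|mean v f x - mean v g y| <= B.
Proof.
move=> fL gK fgB; rewrite -[y](subrK x) [_ + x]addrC mean_shift.
have gK' : lip K (fun z => g (z + (y - x))).
  exact: lip_shift.
rewrite -(meanB _ _ fL gK') -[X in `|X|]subr0.
apply: (@mean_bound (L + K)) => [|r /fgB].
  exact: lipB.
by rewrite subr0 addrAC [x + (y - x)]addrC subrK.
Qed.

Lemma mean_lip L f v : lip L f -> lip L (mean v f).
Proof.
move=> fL x y; apply: (mean_sub_le fL fL) => r _.
by apply: (le_trans (fL _ _)); rewrite opprD addrACA subrr addr0.
Qed.

End Mean.

(** * Riemann sums and directional derivatives of segment averages *)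

Section DirectionalDerivative.
Variables (R : realType) (V : normedModType R).
Implicit Types (f g p : V -> R) (v e x y : V) (L K B eps s : R).

(** On each of the [n.+1] subintervals the increment of a primitive differs from its left-end
    approximation by the oscillation of [f] there times the length. The uniform rate presents
    [mean v f] as a limit of finite averages of translations, to which sub-additivity applies. *)
Lemma mean_riemann L f v x n : 0 <= L -> lip L f ->
  `|mean v f x - n.+1%:R^-1 * \sum_(k < n.+1) f (x + (k%:R / n.+1%:R) *: v)|
    <= L * `|v| / n.+1%:R.
Proof.
move=> L0 fL; set N : R := n.+1%:R.
have N0 : 0 < N by rewrite ltr0Sn.
pose g (r : R) := f (x + r *: v).
have cg : continuous g by exact: continuous_line fL.
have [F dF] := continuous_primitive (-1) cg.
rewrite /mean (integral01_primitive (ltrN10 R) cg dF).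
have <- : F (n.+1%:R / N) = F 1 by rewrite divff ?gt_eqF.
have <- : F (0%:R / N) = F 0 by rewrite mul0r.
rewrite -(telescope_sumr (fun k => F (k%:R / N)) (leq0n n.+1)) big_mkord.
rewrite mulr_sumr -sumrB; apply: (le_trans (ler_norm_sum _ _ _)).
apply: (@le_trans _ _ (\sum_(k < n.+1) (L * `|v| / N) * N^-1)); last first.
  rewrite sumr_const card_ord -mulr_natr -/N -mulrA mulVf ?gt_eqF// mulr1.
  exact: lexx.
apply: ler_sum => k _.
have dk : k.+1%:R / N - k%:R / N = N^-1 by rewrite -mulrBl -natr1 addrAC subrr add0r mul1r.
have k0 : 0 <= k%:R / N by rewrite divr_ge0// ltW.
have N1 : 0 <= N^-1 by rewrite invr_ge0 ltW.
have kb : k%:R / N <= k.+1%:R / N by rewrite -subr_ge0 dk.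
have := @mvt_le _ F g (k%:R / N) (k.+1%:R / N) (g (k%:R / N)) (L * `|v| / N).
rewrite dk [N^-1 * _]mulrC; apply => //.
- by move=> r /andP[kr _]; apply: dF; apply: lt_le_trans kr; apply: lt_le_trans k0; exact: ltrN10.
- move=> r /andP[kr rk]; apply: (le_trans (fL _ _)).
  rewrite opprD addrACA subrr add0r -scalerBl normrZ -[_ * _ / _]mulrA.
  apply: ler_wpM2l => //; rewrite mulrC; apply: ler_wpM2l => //.
  by rewrite ger0_norm ?subr_ge0// -[leRHS]dk lerD2r.
Qed.

(** [p] is the derivative of [f] along [e], with a quadratic remainder uniform in the base point. In
    this form differentiation passes through [mean] by integrating the inequality. *)
Definition has_dir e f p K := forall x s,
  `|f (x + s *: e) - f x - s * p x| <= K * s ^+ 2.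

Lemma has_dir_mean e f p K v L M : lip L f -> lip M p ->
  has_dir e f p K -> has_dir e (mean v f) (mean v p) K.
Proof.
move=> fL pM dfp x s.
rewrite mean_shift -(meanB _ _ (lip_shift (s *: e) fL) fL) -(meanZ _ _ _ pM).
have sp : lip (`|s| * M) (fun y => s * p y).
  by move=> a b; rewrite -mulrBr normrM -mulrA; apply: ler_wpM2l.
rewrite -(meanB _ _ (lipB (lip_shift (s *: e) fL) fL) sp).
rewrite -[X in `|X|]subr0; apply: mean_bound.
  exact: lipB (lipB (lip_shift (s *: e) fL) fL) sp.
by move=> r _; rewrite subr0; exact: dfp.
Qed.

Definition diffq eps e f x : R := (f (x + eps *: e) - f x) / eps.

Lemma diffq_lip eps e f L : 0 < eps -> lip L f -> lip (2 * L / eps) (diffq eps e f).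
Proof.
move=> e0 fL x y; rewrite /diffq -mulrBl normrM (gtr0_norm (x := eps^-1)) ?invr_gt0//.
rewrite [2 * L / eps * _]mulrAC; apply: ler_wpM2r; first by rewrite invr_ge0 ltW.
rewrite mulr_natl mulr2n; exact: (lipB (lip_shift (eps *: e) fL) fL x y).
Qed.

Lemma diffq_bound eps e f L x : 0 <= L -> 0 < eps -> `|e| <= 1 -> lip L f ->
  `|diffq eps e f x| <= L.
Proof.
move=> L0 e0 e1 fL; rewrite /diffq normrM normfV (gtr0_norm e0).
rewrite ler_pdivrMr//; apply: (le_trans (fL _ _)).
rewrite addrAC subrr add0r normrZ (gtr0_norm e0); apply: ler_wpM2l => //.
by rewrite ler_piMr// ltW.
Qed.

Lemma diffq_mean eps e f v L : lip L f ->
  diffq eps e (mean v f) = mean v (diffq eps e f).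
Proof.
move=> fL; apply/funext => x; rewrite /diffq mean_shift.
rewrite -(meanB _ _ (lip_shift (eps *: e) fL) fL) mulrC -(meanZ (L := L + L)).
  by congr mean; apply/funext => y; rewrite mulrC.
exact: lipB (lip_shift (eps *: e) fL) fL.
Qed.

(** Along the line through [x], the average is [(F (t + eps) - F t) / eps] for a primitive [F] of
    [f]; its derivative is the difference quotient of [f], which is Lipschitz with constant
    [2 * L / eps]. *)
Lemma has_dir_mean_self eps e f L : 0 <= L -> 0 < eps -> `|e| <= 1 -> lip L f ->
  has_dir e (mean (eps *: e) f) (diffq eps e f) (2 * L / eps).
Proof.
move=> L0 e0 e1 fL x s.
pose g (r : R) := f (x + r *: e).
have cg : continuous g by exact: continuous_line fL.
(* Every parameter used below is at least -|s|, hence lies where [F] is differentiable. *)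
have [F dF] := continuous_primitive (- `|s| - 1) cg.
pose Phi t := eps^-1 * (F (t + eps) - F t).
have mE t : `|t| <= `|s| -> mean (eps *: e) f (x + t *: e) = Phi t.
  move=> ts; have ts' : - `|s| <= t by rewrite lerNl (le_trans _ ts)// -normrN ler_norm.
  have t0 : (- `|s| - 1 - t) / eps < 0 by rewrite pmulr_llt0 ?invr_gt0//; lra.
  have gE (r : R) : f (x + t *: e + r *: (eps *: e)) = g (eps * r + t).
    by rewrite /g scalerA addrAC -addrA -scalerDl [r * _]mulrC.
  have -> : mean (eps *: e) f (x + t *: e)
      = \int[lebesgue_measure]_(r in `[0, 1]) g (eps * r + t).
    by rewrite /mean; congr Rintegral; apply/funext.
  have -> : Phi t = eps^-1 * F (eps * 1 + t) - eps^-1 * F (eps * 0 + t).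
    by rewrite mulr1 mulr0 add0r -mulrBr [eps + t]addrC.
  (* Change of variable [eps * r + t]: the threshold for [r] is the preimage of the left end of the
     half-line. *)
  apply: (@integral01_primitive _ (fun r => eps^-1 * F (eps * r + t))
    (fun r => g (eps * r + t)) ((- `|s| - 1 - t) / eps)) => //.
  - rewrite (_ : (fun r : R => _) = fun r : R => f (x + t *: e + r *: (eps *: e))).
      exact: continuous_line fL.
    by apply/funext.
  - move=> r; rewrite ltr_pdivrMr// => hr.
    have dr : is_derive (eps * r + t) 1 F (g (eps * r + t)) by apply: dF; lra.
    have := is_derive_affine eps^-1 dr.
    by rewrite [_ * eps]mulrC mulrA mulVf ?gt_eqF// mul1r.
have m0 : mean (eps *: e) f x = Phi 0 by rewrite -mE ?normr0// scale0r addr0.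
rewrite mE// m0 [s * _]mulrC -real_normK ?num_real// expr2 mulrA.
apply: (@mvt0_le _ Phi (fun t => eps^-1 * (g (t + eps) - g t))) => r rs.
  have rs' : - `|s| <= r by rewrite lerNl (le_trans _ rs)// -normrN ler_norm.
  have d1 : is_derive (1 * r + eps) 1 F (g (r + eps)).
    by rewrite mul1r; apply: dF; lra.
  have d0 : is_derive (1 * r + 0) 1 F (g r) by rewrite mul1r addr0; apply: dF; lra.
  have := is_deriveB (is_derive_affine eps^-1 d1) (is_derive_affine eps^-1 d0).
  rewrite !mulr1 mulrBr => dPhi; apply: (@eq_is_derive _ _ Phi _ _ _ dPhi) => t.
  rewrite -[LHS]/(eps^-1 * F (1 * t + eps) - eps^-1 * F (1 * t + 0)).
  by rewrite !mul1r addr0 -mulrBr.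
rewrite /diffq [_ / eps]mulrC -mulrBr normrM gtr0_norm ?invr_gt0//.
have -> : 2 * L / eps * `|s| = eps^-1 * (2 * (L * `|s|)) by ring.
apply: ler_wpM2l; first by rewrite invr_ge0 ltW.
have gE : g (r + eps) = f (x + eps *: e + r *: e).
  by rewrite /g scalerDl [r *: e + _]addrC addrA.
have -> : g (r + eps) - g r - (f (x + eps *: e) - f x)
  = f (x + eps *: e + r *: e) - f (x + eps *: e) - (f (x + r *: e) - f x).
  by rewrite gE /g; ring.
have le_s y : `|f (y + r *: e) - f y| <= L * `|s|.
  apply: (le_trans (fL _ _)); rewrite addrAC subrr add0r normrZ.
  apply: ler_wpM2l => //; apply: le_trans rs; exact: ler_piMr.
apply: (le_trans (ler_normB _ _)); rewrite mulr_natl mulr2n; exact: lerD (le_s (x + eps *: e)) (le_s x).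
Qed.

End DirectionalDerivative.

(** * Taylor expansion in the maximum norm, one coordinate at a time *)

Lemma norm_mx_entry (R : realType) (m n : nat) (A : 'M[R]_(m, n)) i j : `|A i j| <= `|A|.
Proof.
rewrite [leRHS](mx_normrE A).
exact: (le_bigmax_cond _ (fun ij => `|A ij.1 ij.2|) (erefl : xpredT (i, j))).
Qed.

Lemma norm_mx_le (R : realType) (m n : nat) (A : 'M[R]_(m, n)) (c : R) : 0 <= c ->
  (forall i j, `|A i j| <= c) -> `|A| <= c.
Proof.
move=> c0 Ac; rewrite [leLHS](mx_normrE A); exact: bigmax_le.
Qed.

Section Taylor.
Variables (R : realType) (d : nat).
Local Notation V := 'rV[R]_d.
Implicit Types (f h : V -> R) (x y : V) (r : seq 'I_d) (L K b eps s : R).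

Lemma norm_delta_le1 (j : 'I_d) : `|delta_mx 0 j : V| <= 1.
Proof.
by apply: norm_mx_le => // i k; rewrite mxE; case: (_ && _); rewrite ?normr1 ?normr0.
Qed.

(** After subtracting half of [t ^+ 2 * a x], the derivative along the line stays within
    [K' * t ^+ 2] of [p x], and the mean value bound applies. *)
Lemma taylor1d (e : V) f p a K K' x s : has_dir e f p K -> has_dir e p a K' ->
  0 <= K' ->
  `|f (x + s *: e) - f x - s * p x - 2^-1 * s ^+ 2 * a x| <= K' * `|s| ^+ 3.
Proof.
move=> df dp K'0.
pose F t := f (x + t *: e) - 2^-1 * t ^+ 2 * a x.
have xte (t u : R) : x + (t + u) *: e = x + t *: e + u *: e by rewrite scalerDl addrA.
have -> : f (x + s *: e) - f x - s * p x - 2^-1 * s ^+ 2 * a x = F s - F 0 - p x * s.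
  by rewrite /F scale0r addr0; ring.
rewrite exprSr mulrA real_normK ?num_real//.
apply: (@mvt0_le _ F (fun t => p (x + t *: e) - t * a x)) => t ts.
  apply: (@is_derive_quadratic _ _ _ _ (K + 2^-1 * `|a x|)) => h.
  have -> : F (t + h) - F t - h * (p (x + t *: e) - t * a x) =
    (f (x + t *: e + h *: e) - f (x + t *: e) - h * p (x + t *: e))
    - 2^-1 * h ^+ 2 * a x by rewrite /F xte; field.
  apply: (le_trans (ler_normB _ _)); rewrite mulrDl; apply: lerD; first exact: df.
  by rewrite mulrAC normrM (ger0_norm (sqr_ge0 h)) normrM (ger0_norm (x := 2^-1)) ?invr_ge0.
have -> : p (x + t *: e) - t * a x - p x = p (x + t *: e) - p x - t * a x by ring.
apply: (le_trans (dp x t)); apply: ler_wpM2l => //.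
by rewrite -[t ^+ 2]real_normK ?num_real// -[s ^+ 2]real_normK ?num_real// ler_pXn2r.
Qed.

(** The increment [y] restricted to the coordinates listed in [r]; the expansions are proved by
    induction on [r]. *)
Definition vpart r y : V := \sum_(j <- r) y 0 j *: delta_mx 0 j.

Lemma vpart_enum y : vpart (enum 'I_d) y = y.
Proof. by rewrite /vpart big_enum /= -row_sum_delta. Qed.

Lemma vpart_norm r y : `|vpart r y| <= (size r)%:R * `|y|.
Proof.
elim: r => [|j r IH]; first by rewrite /vpart big_nil normr0 mul0r.
rewrite /vpart big_cons -/(vpart r y) /= -natr1 addrC mulrDl mul1r.
apply: (le_trans (ler_normD _ _)); apply: lerD => //; rewrite normrZ.
apply: (@le_trans _ _ (`|y 0 j| * 1)); last by rewrite mulr1; exact: norm_mx_entry.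
by apply: ler_wpM2l => //; exact: norm_delta_le1.
Qed.

Lemma vpart_lip L h r x y : 0 <= L -> lip L h ->
  `|h (x + vpart r y) - h x| <= L * ((size r)%:R * `|y|).
Proof.
move=> L0 hL; apply: (le_trans (hL _ _)); apply: ler_wpM2l => //.
by rewrite addrAC subrr add0r vpart_norm.
Qed.

Lemma vpart_cons j r x y : x + vpart (j :: r) y = x + vpart r y + y 0 j *: delta_mx 0 j.
Proof. by rewrite /vpart big_cons [_ *: _ + _]addrC addrA. Qed.

(** Adding coordinate [j] costs one directional remainder at the intermediate point [v] and the
    shift of [a j] from [v] back to [x]. The constant [K] serves for both. *)
Lemma taylor_order1 h (a : 'I_d -> V -> R) K r x y : 0 <= K ->
  (forall i, has_dir (delta_mx 0 i) h (a i) K) -> (forall i, lip K (a i)) ->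
  `|h (x + vpart r y) - h x - \sum_(i <- r) y 0 i * a i x|
    <= K * (size r)%:R ^+ 2 * `|y| ^+ 2.
Proof.
move=> K0 dh aK; elim: r => [|j r IH].
  by rewrite /vpart !big_nil addr0 subrr subr0 normr0 /= mulr0n expr0n mulr0 mul0r.
rewrite vpart_cons big_cons /= -natr1; set n : R := (size r)%:R in IH *.
have n0 : 0 <= n by rewrite /n.
set v := x + vpart r y in IH *.
have yj := norm_mx_entry y 0 j.
have E1 := dh j v (y 0 j).
have E2 : `|y 0 j * (a j v - a j x)| <= K * n * `|y| ^+ 2.
  rewrite normrM.
  have := ler_pM (normr_ge0 _) (normr_ge0 _) yj (vpart_lip r x y K0 (aK j)).
  by rewrite -/n -/v expr2 => /le_trans -> //; rewrite le_eqVlt; apply/orP; left; apply/eqP; ring.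
have E3 : K * y 0 j ^+ 2 <= K * `|y| ^+ 2.
  by apply: ler_wpM2l => //; rewrite -real_normK ?num_real// ler_pXn2r ?nnegrE.
have -> : h (v + y 0 j *: delta_mx 0 j) - h x - (y 0 j * a j x + \sum_(i <- r) y 0 i * a i x) =
  (h v - h x - \sum_(i <- r) y 0 i * a i x)
  + (h (v + y 0 j *: delta_mx 0 j) - h v - y 0 j * a j v) + y 0 j * (a j v - a j x) by ring.
have y0 : 0 <= `|y| ^+ 2 by rewrite sqr_ge0.
apply: (le_trans (ler_normD _ _)); apply: (le_trans (lerD (ler_normD _ _) (lexx _))).
apply: (le_trans (lerD (lerD IH E1) E2)); apply: (le_trans (lerD (lerD (lexx _) E3) (lexx _))).
(* This is the slack in [n ^+ 2 + 1 + n <= (n + 1) ^+ 2]. *)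
have : 0 <= K * n * `|y| ^+ 2 by rewrite !mulr_ge0.
rewrite -subr_ge0 => h0; rewrite -subr_ge0; apply: le_trans h0 _.
by rewrite le_eqVlt; apply/orP; left; apply/eqP; ring.
Qed.

(** The new coordinate is expanded to second order at the intermediate point, and its first
    derivative is brought back to [x] by [taylor_order1], which creates the mixed terms. The matrix
    [B] need not be symmetric and does not depend on [y]. *)
Lemma taylor_order2 f (p : 'I_d -> V -> R) (a : 'I_d -> 'I_d -> V -> R) K1 K b r x :
  0 <= K -> (forall j, has_dir (delta_mx 0 j) f (p j) K1) ->
  (forall j i, has_dir (delta_mx 0 i) (p j) (a j i) K) ->
  (forall j i, lip K (a j i)) -> (forall j i, `|a j i x| <= b) ->
  exists B : 'M[R]_d, (forall i j, `|B i j| <= (size r)%:R ^+ 2 * b) /\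
    forall y, `|f (x + vpart r y) - f x - \sum_(j <- r) y 0 j * p j x
       - \sum_i \sum_j B i j * y 0 j * y 0 i| <= K * (size r)%:R ^+ 3 * `|y| ^+ 3.
Proof.
move=> K0 df dp aK ab; elim: r => [|j r [B [Bb IH]]].
  exists 0; split=> [i j|y]; first by rewrite mxE normr0 /= mulr0n expr0n mul0r.
  rewrite /vpart !big_nil addr0 subrr subr0 sub0r normrN /= mulr0n expr0n mulr0 mul0r big1 ?normr0// => i _.
  by rewrite big1 // => j _; rewrite mxE !mul0r.
rewrite /= -natr1; set n : R := (size r)%:R in IH Bb *.
have n0 : 0 <= n by rewrite /n.
(* Coefficients contributed by coordinate [j]: half the pure second derivative, and the mixed ones
   with the coordinates already treated. *)
pose E := (2^-1 * a j j x) *: delta_mx j j + \sum_(i <- r) a j i x *: delta_mx j i : 'M[R]_d.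
have b0 : 0 <= b := le_trans (normr_ge0 _) (ab j j).
have dle k l i i' (c : R) : `|c| <= b -> `|(c *: delta_mx i i' : 'M[R]_d) k l| <= b.
  move=> cb; rewrite !mxE normrM; apply: le_trans cb; apply: ler_piMr => //.
  by case: (_ && _); rewrite ?normr1 ?normr0.
exists (B + E); split=> [k l|y].
  rewrite mxE; apply: (le_trans (ler_normD _ _)); apply: (le_trans (lerD (Bb k l) (lexx _))).
  have En : `|E k l| <= b + n * b.
    rewrite mxE; apply: (le_trans (ler_normD _ _)); apply: lerD.
      apply: dle; rewrite normrM; apply: (le_trans _ (ab j j)); apply: ler_piMl => //.
      by rewrite ger0_norm; lra.
    rewrite summxE; apply: (le_trans (ler_norm_sum _ _ _)).
    rewrite /n mulr_natl -sum1_size -sumrMnr; apply: ler_sum => i _; exact: dle.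
  apply: (le_trans (lerD (lexx _) En)).
  rewrite -subr_ge0 (_ : _ - _ = n * b); last by ring.
  exact: mulr_ge0.
have qE : \sum_k \sum_l E k l * y 0 l * y 0 k =
    2^-1 * y 0 j ^+ 2 * a j j x + y 0 j * \sum_(i <- r) y 0 i * a j i x.
  have qd i i' (c : R) :
      \sum_k \sum_l (c *: delta_mx i i' : 'M[R]_d) k l * y 0 l * y 0 k = c * y 0 i' * y 0 i.
    rewrite (bigD1 i) //= [X in _ + X]big1 ?addr0; last first.
      move=> k ki; rewrite big1 // => l _.
      by rewrite !mxE (negbTE ki) mulr0 !mul0r.
    rewrite (bigD1 i') //= [X in _ + X]big1 ?addr0; last first.
      by move=> l li; rewrite !mxE (negbTE li) andbF mulr0 !mul0r.
    by rewrite !mxE !eqxx mulr1.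
  transitivity (\sum_k \sum_l ((2^-1 * a j j x) *: delta_mx j j : 'M[R]_d) k l * y 0 l * y 0 k
    + \sum_(i <- r) \sum_k \sum_l (a j i x *: delta_mx j i : 'M[R]_d) k l * y 0 l * y 0 k).
    rewrite [X in _ = _ + X]exchange_big -big_split /=; apply: eq_bigr => k _.
    rewrite [X in _ = _ + X]exchange_big -big_split /=; apply: eq_bigr => l _.
    by rewrite /E mxE summxE !mulrDl !mulr_suml.
  by congr (_ + _); [|rewrite mulr_sumr; apply: eq_bigr => i _]; rewrite qd; ring.
have -> : \sum_k \sum_l (B + E) k l * y 0 l * y 0 k =
    \sum_k \sum_l B k l * y 0 l * y 0 k + \sum_k \sum_l E k l * y 0 l * y 0 k.
  rewrite -big_split; apply: eq_bigr => k _; rewrite -big_split; apply: eq_bigr => l _.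
  by rewrite mxE !mulrDl.
rewrite qE vpart_cons big_cons; set v := x + vpart r y.
have yj := norm_mx_entry y 0 j.
have y0 : 0 <= `|y| by [].
have yj0 := normr_ge0 (y 0 j).
have E1 : `|f (v + y 0 j *: delta_mx 0 j) - f v - y 0 j * p j v
    - 2^-1 * y 0 j ^+ 2 * a j j v| <= K * `|y| ^+ 3.
  apply: (le_trans (taylor1d _ _ (df j) (dp j j) K0)); apply: ler_wpM2l => //.
  by rewrite ler_pXn2r ?nnegrE.
have E2 : `|y 0 j * (p j v - p j x - \sum_(i <- r) y 0 i * a j i x)|
    <= K * n ^+ 2 * `|y| ^+ 3.
  rewrite normrM [`|y| ^+ 3]exprS [K * _ * _]mulrCA; apply: ler_pM => //.
  exact: taylor_order1.
have E3 : `|2^-1 * y 0 j ^+ 2 * (a j j v - a j j x)| <= K * n * `|y| ^+ 3.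
  have h1 : `|2^-1 * y 0 j ^+ 2| <= `|y| ^+ 2.
    rewrite normrM normrX; apply: (@le_trans _ _ (`|y 0 j| ^+ 2)).
      by apply: ler_piMl; rewrite ?exprn_ge0// ger0_norm; lra.
    by rewrite ler_pXn2r ?nnegrE.
  rewrite normrM (_ : K * n * _ = `|y| ^+ 2 * (K * (n * `|y|))); last by ring.
  by apply: ler_pM => //; exact: vpart_lip.
set s1 := \sum_(i <- r) y 0 i * a j i x in E2 *.
set s2 := \sum_(i <- r) y 0 i * p i x in IH *.
set s3 := \sum_k _ in IH *.
(* Four errors: the inductive one, the one-dimensional remainder at [v], and the shifts of the first
   and second derivatives from [v] to [x]. Together they use [n ^+ 3 + 1 + n ^+ 2 + n] out of
   [(n + 1) ^+ 3]. *)
have -> : f (v + y 0 j *: delta_mx 0 j) - f x - (y 0 j * p j x + s2)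
    - (s3 + (2^-1 * y 0 j ^+ 2 * a j j x + y 0 j * s1)) =
  (f v - f x - s2 - s3)
  + (f (v + y 0 j *: delta_mx 0 j) - f v - y 0 j * p j v - 2^-1 * y 0 j ^+ 2 * a j j v)
  + y 0 j * (p j v - p j x - s1) + 2^-1 * y 0 j ^+ 2 * (a j j v - a j j x) by ring.
apply: (le_trans (ler_normD _ _)); apply: (le_trans (lerD (ler_normD _ _) E3)).
apply: (le_trans (lerD (lerD (ler_normD _ _) E2) (lexx _))).
apply: (le_trans (lerD (lerD (lerD (IH y) E1) (lexx _)) (lexx _))).
rewrite -subr_ge0 (_ : _ - _ = K * `|y| ^+ 3 * (2 * n ^+ 2 + 2 * n)); last by ring.
by rewrite mulr_ge0 ?mulr_ge0 ?exprn_ge0// addr_ge0 ?mulr_ge0 ?exprn_ge0.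
Qed.

End Taylor.

(** * The smoothing operator and its third-order Taylor estimate *)

Section Smoothing.
Variables (R : realType) (d : nat).
Local Notation V := 'rV[R]_d.
Implicit Types (f g p : V -> R) (x y : V) (r : seq 'I_d) (L K b eps s : R).

Definition means eps r f : V -> R :=
  foldr (fun j => mean (eps *: delta_mx 0 j)) f r.

Lemma means_lip eps r f L : lip L f -> lip L (means eps r f).
Proof. by move=> fL; elim: r => //= j r IH; exact: mean_lip. Qed.

Lemma means_bound L eps r f b x : lip L f -> (forall y, `|f y| <= b) ->
  `|means eps r f x| <= b.
Proof.
move=> fL fb; elim: r x => //= j r IH x.
rewrite -[means _ _ _]/(means eps r f) -[X in `|X|]subr0.
by apply: (mean_bound (means_lip eps r fL)) => t _; rewrite subr0.
Qed.

Lemma means_close eps r f L x : 0 <= L -> 0 <= eps -> lip L f ->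
  `|means eps r f x - f x| <= (size r)%:R * (L * eps).
Proof.
move=> L0 e0 fL; elim: r x => [|j r IH] x.
  by rewrite subrr normr0 mul0r.
rewrite /= -/(means eps r f) -natr1 mulrDl mul1r.
have gL := means_lip eps r fL.
rewrite -[X in `|X|](subrKA (means eps r f x)) addrC; apply: (le_trans (ler_normD _ _)).
rewrite addrC [leRHS]addrC; apply: lerD => //.
apply: (mean_bound gL) => t /andP[t0 t1]; apply: (le_trans (gL _ _)).
rewrite addrAC subrr add0r !normrZ !ger0_norm//; apply: ler_wpM2l => //.
rewrite mulrA -[leRHS]mulr1; apply: ler_pM; rewrite ?mulr_ge0//.
  by apply: ler_piMl.
exact: norm_delta_le1.
Qed.

Lemma diffq_means eps r e f L : lip L f ->
  diffq eps e (means eps r f) = means eps r (diffq eps e f).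
Proof.
move=> fL; elim: r => //= j r IH.
by rewrite (diffq_mean _ _ _ (means_lip eps r fL)) [X in mean _ X]IH.
Qed.

(** Averages standing before the first [j] are crossed by [has_dir_mean]; the average in direction
    [j] is then traded for a difference quotient, hence the list [rem j r]. *)
Lemma has_dir_means eps r j f L : 0 <= L -> 0 < eps -> lip L f -> j \in r ->
  has_dir (delta_mx 0 j) (means eps r f)
    (means eps (rem j r) (diffq eps (delta_mx 0 j) f)) (2 * L / eps).
Proof.
move=> L0 e0 fL; elim: r => //= i r IH; rewrite inE; case: (eqVneq i j) => [->|ij].
  move=> _; rewrite -(diffq_means _ _ _ fL); apply: has_dir_mean_self => //.
    exact: norm_delta_le1.
  exact: means_lip.
move=> /= jr.
apply: has_dir_mean (IH jr); first exact: means_lip fL.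
by apply: means_lip; exact: diffq_lip.
Qed.

(* Two averages per coordinate make the second derivatives Lipschitz. *)
Definition smooth eps := means eps (enum 'I_d ++ enum 'I_d).

(** Each differentiation consumes one average in its direction, and two are available for every
    coordinate. The second derivatives are averages of double difference quotients, bounded by
    [2 * L / eps] and Lipschitz with one more factor [2 / eps]. The bounds depend neither on [x] nor
    on [f] beyond [L]. *)
Lemma smooth_taylor eps f L x : 0 < eps -> 0 <= L -> lip L f ->
  exists (p : 'I_d -> R) (A : 'M[R]_d),
    [/\ A^T = A, (forall i j, `|A i j| <= 2 * (d%:R ^+ 2 * (2 * L / eps))) &
     forall y, `|smooth eps f (x + y) - smooth eps f x - \sum_j y 0 j * p j
       - 2^-1 * qform A y| <= 2 * (2 * L / eps) / eps * d%:R ^+ 3 * `|y| ^+ 3].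
Proof.
move=> e0 L0 fL; set E := enum 'I_d.
pose D j := diffq eps (delta_mx 0 j : V).
(* Membership before and after removing one copy of [j]; the second fact also covers [i = j]. *)
have mE (j : 'I_d) : j \in E ++ E by rewrite mem_cat mem_enum.
have mrE (i j : 'I_d) : i \in rem j (E ++ E).
  have /permP /(_ (pred1 i)) := perm_to_rem (mE j).
  rewrite count_cat /= !(count_uniq_mem _ (enum_uniq _)) !mem_enum -has_pred1 has_count.
  by case: (j == i); case: (count _ _).
have L1 : 0 <= 2 * L / eps by rewrite divr_ge0 ?mulr_ge0// ltW.
have DL j : lip (2 * L / eps) (D j f) by exact: diffq_lip.
have [|||||B [Bb HB]] := @taylor_order2 R d (smooth eps f)
  (fun j => means eps (rem j (E ++ E)) (D j f))
  (fun j i => means eps (rem i (rem j (E ++ E))) (D i (D j f)))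
  (2 * L / eps) (2 * (2 * L / eps) / eps) (2 * L / eps) E x.
- exact: divr_ge0 (mulr_ge0 (ler0n _ 2) L1) (ltW e0).
- by move=> j; exact: has_dir_means L0 e0 fL (mE j).
- by move=> j i; exact: has_dir_means L1 e0 (DL j) (mrE i j).
- by move=> j i; apply: means_lip; exact: diffq_lip.
- move=> j i; apply: (@means_bound (2 * (2 * L / eps) / eps)).
    exact: diffq_lip.
  by move=> y; apply: diffq_bound => //; exact: norm_delta_le1.
rewrite /E size_enum_ord in Bb HB.
(* Symmetrising doubles the quadratic form, which the factor one half in the statement
   compensates. *)
exists (fun j => means eps (rem j (E ++ E)) (D j f) x), (B + B^T); split.
- by rewrite linearD /= trmxK addrC.
- move=> i j; rewrite !mxE (mulr_natl _ 2) mulr2n.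
  by apply: (le_trans (ler_normD _ _)); apply: lerD.
- move=> y; have := HB y; rewrite vpart_enum big_enum /=.
  suff -> : 2^-1 * qform (B + B^T) y = \sum_i \sum_j B i j * y 0 j * y 0 i by [].
  rewrite /qform; set q := RHS.
  have -> : \sum_i \sum_j (B + B^T) i j * y 0 j * y 0 i = q + q.
    have qT : q = \sum_i \sum_j B j i * y 0 i * y 0 j by rewrite /q exchange_big.
    rewrite {2}qT -big_split; apply: eq_bigr => i _.
    rewrite -big_split; apply: eq_bigr => j _; rewrite !mxE /=; ring.
  by field.
Qed.

End Smoothing.

(** * Euclidean norm against maximum norm, and the classes of test functions *)

Section EuclideanNorm.
Variable R : realType.

Lemma mulr_sum_ord (n : nat) (t : R) : n%:R * t = \sum_(j < n) t.
Proof. by rewrite sumr_const card_ord mulr_natl. Qed.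

Lemma enorm_ge0 (m n : nat) (A : 'M[R]_(m, n)) : 0 <= enorm A.
Proof. exact: sqrtr_ge0. Qed.

Lemma enorm_sqr (m n : nat) (A : 'M[R]_(m, n)) : enorm A ^+ 2 = \sum_i \sum_j A i j ^+ 2.
Proof. by rewrite sqr_sqrtr// !sumr_ge0// => i _; rewrite sumr_ge0// => j _; exact: sqr_ge0. Qed.

Lemma enorm_entry (m n : nat) (A : 'M[R]_(m, n)) i j : `|A i j| <= enorm A.
Proof.
rewrite -sqrtr_sqr; apply: ler_wsqrtr.
rewrite (bigD1 i) //= (bigD1 j) //= -addrA lerDl addr_ge0//.
  by apply: sumr_ge0 => *; exact: sqr_ge0.
by apply: sumr_ge0 => *; apply: sumr_ge0 => *; exact: sqr_ge0.
Qed.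

Lemma norm_le_enorm (m n : nat) (A : 'M[R]_(m, n)) : `|A| <= enorm A.
Proof. by apply: norm_mx_le; [exact: enorm_ge0|exact: enorm_entry]. Qed.

(** Multiplied by [enorm x + enorm y], the difference becomes a difference of squares, which factors
    coordinate by coordinate. The case where this sum vanishes is treated apart. *)
Lemma enorm_lip (n : nat) : lip n%:R (@enorm R 1 n).
Proof.
move=> x y; have [xy0|xy0] := eqVneq (enorm x + enorm y) 0.
  have := enorm_ge0 x; have := enorm_ge0 y => y0 x0.
  have -> : enorm x - enorm y = 0 by lra.
  by rewrite normr0 mulr_ge0.
have s0 : 0 < enorm x + enorm y by rewrite lt_def xy0 addr_ge0 ?enorm_ge0.
rewrite -(ler_pM2r s0) -[X in `|_| * X](gtr0_norm s0) -normrM -subr_sqr !enorm_sqr.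
rewrite !big_ord1 -sumrB; apply: (le_trans (ler_norm_sum _ _ _)).
rewrite -mulrA mulr_sum_ord.
apply: ler_sum => j _; rewrite subr_sqr normrM; apply: ler_pM => //.
  by have := norm_mx_entry (x - y) 0 j; rewrite !mxE.
by apply: (le_trans (ler_normD _ _)); apply: lerD; exact: enorm_entry.
Qed.

Lemma enorm_le_norm (m n : nat) (A : 'M[R]_(m, n)) : enorm A <= (m * n)%:R * `|A|.
Proof.
rewrite -(@ler_pXn2r _ 2)// ?nnegrE ?enorm_ge0 ?mulr_ge0//.
rewrite enorm_sqr exprMn; apply: (@le_trans _ _ ((m * n)%:R * `|A| ^+ 2)).
  rewrite natrM -mulrA mulr_sum_ord.
  apply: ler_sum => i _; rewrite mulr_sum_ord.
  apply: ler_sum => j _; rewrite -real_normK ?num_real// ler_pXn2r ?nnegrE//.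
  exact: norm_mx_entry.
apply: ler_wpM2r; first exact: sqr_ge0.
by rewrite -natrX ler_nat; case: (m * n)%N => // k; rewrite expnS leq_pmulr.
Qed.

Lemma lip_C_lLip (n : nat) (L : R) (phi : 'rV[R]_n -> R) : lip L phi -> C_lLip phi.
Proof.
move=> phiL; exists (`|L| + 1); split; first by rewrite ltr_wpDl.
exists 0%N => x y; apply: (le_trans (phiL x y)); rewrite !expr0.
have L0 := normr_ge0 L; have LL := ler_norm L.
apply: (@le_trans _ _ (`|L| * enorm (x - y))).
  apply: (le_trans (ler_wpM2r (normr_ge0 _) LL)); apply: ler_wpM2l => //.
  exact: norm_le_enorm.
by apply: ler_wpM2r; [exact: enorm_ge0|lra].
Qed.

Definition bounded_lip (n : nat) (phi : 'rV[R]_n -> R) :=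
  exists B L : R, [/\ 0 <= L, forall x, `|phi x| <= B & lip L phi].

Lemma C_bLipP (n : nat) (phi : 'rV[R]_n -> R) : C_bLip phi <-> bounded_lip phi.
Proof.
split=> [[[M [Mr bM]] [L phiL]]|[B [L [L0 phiB phiL]]]].
  (* [bounded_fun] provides a bound by every real strictly above [M], hence [M + 1]. *)
  exists (M + 1), (`|L| * n%:R); split.
  - by rewrite mulr_ge0.
  - by move=> x; apply: bM => //; rewrite ltrDl.
  - move=> x y; apply: (le_trans (phiL x y)); rewrite -mulrA.
    apply: (le_trans (ler_wpM2r (enorm_ge0 _) (ler_norm L))); apply: ler_wpM2l => //.
    by have := enorm_le_norm (x - y); rewrite mul1n.
split; last first.
  exists L => x y; apply: (le_trans (phiL x y)); apply: ler_wpM2l => //.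
  exact: norm_le_enorm.
exists B; split; first exact: num_real.
by move=> z Bz x _; apply: le_trans (phiB x) (ltW Bz).
Qed.

End EuclideanNorm.

(** * Sublinear expectations and variables without mean uncertainty *)

Section SublinearExpectation.
Variables (R : realType) (S : sublinear_space R).
Implicit Types (X Y W : S -> R) (a b c : R).

Lemma Hsp_lip (n : nat) (X : S -> 'rV[R]_n) (f : 'rV[R]_n -> R) L :
  random_vector X -> lip L f -> Hsp (fun w => f (X w)).
Proof.
move=> hX fL.
have -> : (fun w => f (X w)) = (fun w => f (\row_i X w 0 i)).
  by apply/funext => w; congr f; apply/rowP => i; rewrite mxE.
apply: (@Hsp_comp _ S n (fun i w => X w 0 i)) => //.
exact: lip_C_lLip fL.
Qed.

(** The product of two coordinates is locally Lipschitz with linear growth, so it is an admissible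
    [phi] in [Hsp_comp]. *)
Lemma HspM X Y : Hsp X -> Hsp Y -> Hsp (fun w => X w * Y w).
Proof.
move=> hX hY.
pose Z (i : 'I_2) : S -> R := if i == 0 then X else Y.
pose phi (z : 'rV[R]_2) : R := z 0 0 * z 0 1.
have -> : (fun w => X w * Y w) = (fun w => phi (\row_i Z i w)).
  by apply/funext => w; rewrite /phi !mxE.
apply: Hsp_comp => [i|]; first by rewrite /Z; case: ifP.
exists 1; split=> //; exists 1%N => x y; rewrite mul1r !expr1 /phi.
have -> : x 0 0 * x 0 1 - y 0 0 * y 0 1 = x 0 0 * (x - y) 0 1 + y 0 1 * (x - y) 0 0.
  by rewrite !mxE; ring.
apply: (le_trans (ler_normD _ _)); rewrite !normrM.
apply: (@le_trans _ _ (enorm x * enorm (x - y) + enorm y * enorm (x - y))).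
  by apply: lerD; apply: ler_pM => //; exact: enorm_entry.
by rewrite -mulrDl; apply: ler_wpM2r; [exact: enorm_ge0|lra].
Qed.

Lemma HspN X : Hsp X -> Hsp (fun w => - X w).
Proof. by move=> /(Hsp_scale (-1)); under eq_fun do rewrite mulN1r. Qed.

Lemma Hsp_sum (I : Type) (r : seq I) (X : I -> S -> R) :
  (forall i, Hsp (X i)) -> Hsp (fun w => \sum_(i <- r) X i w).
Proof.
move=> hX; elim: r => [|i r IH]; first by under eq_fun do rewrite big_nil; exact: Hsp_cst.
by under eq_fun do rewrite big_cons; exact: Hsp_add.
Qed.

Lemma Hsp_enorm3 (n : nat) (X : S -> 'rV[R]_n) : random_vector X ->
  Hsp (fun w => enorm (X w) ^+ 3).
Proof.
move=> hX; have hE := Hsp_lip hX (@enorm_lip R n).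
by under eq_fun do rewrite !exprS expr0 mulr1; do !apply: HspM.
Qed.

Lemma Hsp_qform (n : nat) (X : S -> 'rV[R]_n) A : random_vector X ->
  Hsp (fun w => qform A (X w)).
Proof.
move=> hX; apply: Hsp_sum => i; apply: Hsp_sum => j.
by apply: HspM => //; apply: Hsp_scale.
Qed.

Lemma Esp_close X Y W : Hsp X -> Hsp Y -> Hsp W ->
  (forall w, `|X w - Y w| <= W w) -> `|Esp X - Esp Y| <= Esp W.
Proof.
move=> hX hY hW XYW.
have le X' Y' : Hsp X' -> Hsp Y' -> (forall w, X' w <= Y' w + W w) -> Esp X' <= Esp Y' + Esp W.
  move=> hX' hY' le; apply: le_trans (Esp_subadd hY' hW).
  by apply: Esp_mono => //; exact: Hsp_add.
have XY : Esp X <= Esp Y + Esp W.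
  by apply: le => // w; have := XYW w; rewrite ler_norml => /andP[]; lra.
have YX : Esp Y <= Esp X + Esp W.
  by apply: le => // w; have := XYW w; rewrite ler_norml => /andP[]; lra.
by rewrite ler_norml; apply/andP; split; lra.
Qed.

Lemma Esp_addc X c : Hsp X -> Esp (fun w => X w + c) = Esp X + c.
Proof.
move=> hX; apply/le_anti/andP; split.
  by rewrite -[c in leRHS](Esp_cst S); apply: Esp_subadd => //; exact: Hsp_cst.
have hc : Hsp (fun w => X w + c) by apply: Hsp_add => //; exact: Hsp_cst.
have := Esp_subadd hc (Hsp_cst S (- c)).
under eq_fun do rewrite addrK.
by rewrite Esp_cst lerBrDr.
Qed.

(** Absence of mean uncertainty. Such terms can be added without changing an expectation, which
    removes the first-order part of a Taylor expansion. *)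
Definition centered X := [/\ Hsp X, Esp X = 0 & Esp (fun w => - X w) = 0].

(** Sub-additivity is used twice, the second time on [X = (X + Y) + (- Y)]. *)
Lemma Esp_add_centered X Y : Hsp X -> centered Y -> Esp (fun w => X w + Y w) = Esp X.
Proof.
move=> hX [hY Y0 NY0]; apply/le_anti/andP; split.
  by have := Esp_subadd hX hY; rewrite Y0 addr0.
have := Esp_subadd (Hsp_add hX hY) (HspN hY).
by under eq_fun do rewrite addrK; rewrite NY0 addr0.
Qed.

Lemma centeredD X Y : centered X -> centered Y -> centered (fun w => X w + Y w).
Proof.
move=> cX cY; case: (cX) (cY) => hX X0 NX0 [hY Y0 NY0]; split.
- exact: Hsp_add.
- by rewrite Esp_add_centered.
- under eq_fun do rewrite opprD.
  rewrite Esp_add_centered//; first exact: HspN.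
  by split; rewrite ?NY0//; [exact: HspN|under eq_fun do rewrite opprK].
Qed.

(** Homogeneity handles [0 <= c]; a negative [c] exchanges the two vanishing expectations. *)
Lemma centeredZ c X : centered X -> centered (fun w => c * X w).
Proof.
move=> [hX X0 NX0].
have pos a : 0 <= a -> Esp (fun w => a * X w) = 0 /\ Esp (fun w => - (a * X w)) = 0.
  move=> a0; split; first by rewrite Esp_scale// X0 mulr0.
  by under eq_fun do rewrite -mulrN; rewrite Esp_scale ?NX0 ?mulr0//; exact: HspN.
split; first exact: Hsp_scale.
- have [c0|c0] := leP 0 c; first by case: (pos c c0).
  have [] := pos (- c); first by rewrite oppr_ge0 ltW.
  by move=> _; under eq_fun do rewrite mulNr opprK.
- have [c0|c0] := leP 0 c; first by case: (pos c c0).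
  have [] := pos (- c); first by rewrite oppr_ge0 ltW.
  by under eq_fun do rewrite mulNr.
Qed.

Lemma centered_sum (I : Type) (r : seq I) (X : I -> S -> R) :
  (forall i, centered (X i)) -> centered (fun w => \sum_(i <- r) X i w).
Proof.
move=> hX; elim: r => [|i r IH].
  under eq_fun do rewrite big_nil.
  by split; rewrite ?Esp_cst ?oppr0//; exact: Hsp_cst.
by under eq_fun do rewrite big_cons; exact: centeredD.
Qed.

End SublinearExpectation.

(** * The one-step operator: Jensen's inequality and Taylor estimate *)

Section Transition.
Variables (R : realType) (S : sublinear_space R) (d : nat).
Variables (X : S -> 'rV[R]_d) (c : R).
Hypothesis hX : random_vector X.
Local Notation V := 'rV[R]_d.
Implicit Types (f g : V -> R) (x y v : V) (L K B eps : R).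

Definition transition f x : R := Esp (fun w : S => f (x + c *: X w)).

Lemma lip_affine f x L : 0 <= L -> lip L f -> lip (L * `|c|) (fun z => f (x + c *: z)).
Proof.
move=> L0 fL y z; apply: (le_trans (fL _ _)).
by rewrite opprD addrACA subrr add0r -scalerBr normrZ mulrA.
Qed.

Lemma Hsp_transition f x L : 0 <= L -> lip L f -> Hsp (fun w => f (x + c *: X w)).
Proof. by move=> L0 fL; exact: Hsp_lip hX (lip_affine x L0 fL). Qed.

Lemma transition_lip f L : 0 <= L -> lip L f -> lip L (transition f).
Proof.
move=> L0 fL x y; rewrite -[leRHS](Esp_cst S).
apply: Esp_close; [exact: Hsp_transition fL|exact: Hsp_transition fL|exact: Hsp_cst|].
by move=> w; apply: (le_trans (fL _ _)); rewrite opprD addrACA subrr addr0.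
Qed.

Lemma transition_mono f g L K x : 0 <= L -> 0 <= K -> lip L f -> lip K g ->
  (forall y, f y <= g y) -> transition f x <= transition g x.
Proof.
move=> L0 K0 fL gK fg; apply: Esp_mono => //; first exact: Hsp_transition gK.
exact: Hsp_transition fL.
Qed.

Lemma transition_bound f L B x : 0 <= L -> lip L f -> (forall y, `|f y| <= B) ->
  `|transition f x| <= B.
Proof.
move=> L0 fL fB; rewrite -[transition f x]subr0 -{1}(Esp_cst S 0) -[leRHS](Esp_cst S).
apply: Esp_close; [exact: Hsp_transition fL|exact: Hsp_cst|exact: Hsp_cst|].
by move=> w; rewrite subr0.
Qed.

Lemma transition_addc f L a x : 0 <= L -> lip L f ->
  transition (fun y => f y + a) x = transition f x + a.
Proof. by move=> L0 fL; rewrite /transition Esp_addc//; exact: Hsp_transition fL. Qed.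

Lemma Esp_sum_le (I : Type) (r : seq I) (Y : I -> S -> R) :
  (forall i, Hsp (Y i)) ->
  Esp (fun w : S => \sum_(i <- r) Y i w) <= \sum_(i <- r) Esp (Y i).
Proof.
move=> hY; elim: r => [|i r IH].
  by under eq_fun do rewrite big_nil; rewrite big_nil Esp_cst.
under eq_fun do rewrite big_cons; rewrite big_cons.
apply: (le_trans (Esp_subadd (hY i) (Hsp_sum r hY))).
by rewrite lerD2l.
Qed.

(** Jensen's inequality for finite averages of translations, from sub-additivity and homogeneity. *)
Lemma transition_avg f L n (v : 'I_n -> V) x : 0 <= L -> lip L f ->
  transition (fun y => n%:R^-1 * \sum_(k < n) f (y + v k)) x <=
  n%:R^-1 * \sum_(k < n) transition f (x + v k).
Proof.
move=> L0 fL.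
have hf (k : 'I_n) : Hsp (fun w => f (x + c *: X w + v k)).
  by under eq_fun do rewrite addrAC; exact: Hsp_transition fL.
rewrite /transition Esp_scale ?invr_ge0//; last exact: Hsp_sum.
apply: ler_wpM2l; first by rewrite invr_ge0.
apply: le_trans (Esp_sum_le _ hf) _; apply: ler_sum => k _.
by under eq_fun do rewrite addrAC.
Qed.

(** Jensen's inequality passes from Riemann sums to the integral: [f] and [transition f] share the
    Lipschitz constant [L], so both sums carry the same error. *)
Lemma transition_mean f L v x : 0 <= L -> lip L f ->
  transition (mean v f) x <= mean v (transition f) x.
Proof.
move=> L0 fL; apply/ler_addgt0Pr => e e0.
(* Chosen so that the two Riemann errors add up to at most [e]. *)
pose n := Num.truncn (2 * (L * `|v|) / e).
have en : 2 * (L * `|v| / n.+1%:R) <= e.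
  rewrite mulrA ler_pdivrMr ?ltr0Sn// [e * _]mulrC -ler_pdivrMr//.
  by apply: ltW; exact: truncnS_gt.
pose F y : R := n.+1%:R^-1 * \sum_(k < n.+1) f (y + (k%:R / n.+1%:R) *: v).
have Flip : lip L F.
  move=> y z; rewrite /F -mulrBr -sumrB normrM ger0_norm ?invr_ge0//.
  rewrite ler_pdivrMl ?ltr0Sn// mulr_sum_ord.
  apply: (le_trans (ler_norm_sum _ _ _)); apply: ler_sum => k _.
  exact: (lip_shift _ fL).
have h1 : transition (mean v f) x <= transition F x + L * `|v| / n.+1%:R.
  rewrite -(transition_addc _ _ L0 Flip); apply: (@transition_mono _ _ L L) => //.
  - exact: mean_lip.
  - by move=> y z; rewrite opprD addrACA subrr addr0.
  - move=> y; rewrite -lerBlDl; apply: le_trans (ler_norm _) _.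
    exact: mean_riemann.
have h2 := mean_riemann v x n L0 (transition_lip L0 fL).
have h3 := transition_avg (fun k : 'I_n.+1 => (k%:R / n.+1%:R) *: v) x L0 fL.
rewrite -/F in h3.
move: h2; rewrite distrC => /(le_trans (ler_norm _)); rewrite lerBlDl => h2.
apply: (le_trans h1); apply: (le_trans (lerD (le_trans h3 h2) (lexx _))).
rewrite -addrA lerD2l; apply: le_trans en; rewrite mulr_natl mulr2n; exact: lexx.
Qed.

Lemma transition_means f L eps r x : 0 <= L -> lip L f ->
  transition (means eps r f) x <= means eps r (transition f) x.
Proof.
move=> L0 fL; elim: r x => //= j r IH x.
have mL := means_lip eps r fL.
apply: (le_trans (transition_mean (eps *: delta_mx 0 j) x L0 mL)).
exact: mean_mono (transition_lip L0 mL) (means_lip eps r (transition_lip L0 fL)) IH.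
Qed.

(** The linear term is centered and drops out exactly, the quadratic term yields [c ^+ 2] times its
    expectation, and the cubic remainder is dominated by the third moment. *)
Lemma transition_taylor f L p A K x : 0 <= L -> lip L f -> 0 <= K ->
  (forall j, centered (fun w => X w 0 j)) ->
  (forall y, `|f (x + y) - f x - \sum_j y 0 j * p j - 2^-1 * qform A y|
     <= K * `|y| ^+ 3) ->
  `|transition f x - f x - c ^+ 2 * (2^-1 * Esp (fun w : S => qform A (X w)))|
    <= K * `|c| ^+ 3 * Esp (fun w : S => enorm (X w) ^+ 3).
Proof.
move=> L0 fL K0 cX tay.
have hq : Hsp (fun w => c ^+ 2 * 2^-1 * qform A (X w)).
  by apply: Hsp_scale; exact: Hsp_qform.
have h3 := Hsp_enorm3 hX.
have cp : centered (fun w => \sum_j (c * p j) * X w 0 j).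
  by apply: centered_sum => j; exact: centeredZ.
have c2 : 0 <= c ^+ 2 * 2^-1 by rewrite mulr_ge0 ?sqr_ge0 ?invr_ge0.
have c3 : 0 <= K * `|c| ^+ 3 by rewrite mulr_ge0 ?exprn_ge0.
(* Every term is moved inside an expectation, and the centered linear term is inserted at no cost,
   to reach the form of [Esp_close]. *)
rewrite -(Esp_scale c3 h3) mulrA -(Esp_scale c2 (Hsp_qform A hX)) -addrA -opprD [f x + _]addrC.
rewrite -(Esp_addc _ hq) -(Esp_add_centered _ cp); last first.
  by apply: Hsp_add => //; exact: Hsp_cst.
apply: Esp_close.
- exact: Hsp_transition fL.
- by case: cp => hp _ _; apply: Hsp_add => //; apply: Hsp_add => //; exact: Hsp_cst.
- exact: Hsp_scale.
move=> w; have := tay (c *: X w).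
have -> : qform A (c *: X w) = c ^+ 2 * qform A (X w).
  rewrite /qform mulr_sumr; apply: eq_bigr => i _; rewrite mulr_sumr.
  by apply: eq_bigr => j _; rewrite !mxE; ring.
have -> : \sum_j (c *: X w) 0 j * p j = \sum_j (c * p j) * X w 0 j.
  by apply: eq_bigr => j _; rewrite !mxE; ring.
rewrite normrZ exprMn [K * _]mulrA => h.
apply: le_trans (_ : _ <= K * `|c| ^+ 3 * `|X w| ^+ 3) _; last first.
  by apply: ler_wpM2l => //; rewrite ler_pXn2r ?nnegrE ?norm_le_enorm// enorm_ge0.
apply: le_trans h; rewrite le_eqVlt; apply/orP; left; apply/eqP; congr `|_|; ring.
Qed.

End Transition.

(** * Comparison of two chains *)

Section Comparison.
Variables (R : realType) (d : nat).
Local Notation V := 'rV[R]_d.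
Variables (S1 S2 : sublinear_space R) (X : nat -> S1 -> V) (Y : nat -> S2 -> V) (c : R).
Hypotheses (hX : forall k, random_vector (X k)) (hY : forall k, random_vector (Y k)).

(* Since [smooth eps] is an average of translations, it satisfies
   [transition (smooth f) <= smooth (transition f)]: the smoothed value function of the
   [X]-chain is a supersolution of the [Y]-chain up to the one-step errors. *)
Lemma chain_comparison (phi : V -> R) (L eps : R) (eta : nat -> R) (s : seq nat) x :
  0 <= L -> 0 <= eps -> lip L phi ->
  (forall k (g : V -> R) y, lip L g ->
     transition (Y k) c (smooth eps g) y <= transition (X k) c (smooth eps g) y + eta k) ->
  foldr (fun k => transition (Y k) c) phi s x <=
  foldr (fun k => transition (X k) c) phi s x
    + 2 * ((size (enum 'I_d ++ enum 'I_d))%:R * (L * eps)) + \sum_(k <- s) eta k.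
Proof.
move=> L0 e0 phiL YX; set C := _ * (L * eps).
pose u t := foldr (fun k => transition (X k) c) phi t.
pose v t := foldr (fun k => transition (Y k) c) phi t.
have uL t : lip L (u t) by elim: t => //= k t IH; exact: transition_lip.
have vL t : lip L (v t) by elim: t => //= k t IH; exact: transition_lip.
have close (g : V -> R) y : lip L g -> `|smooth eps g y - g y| <= C by exact: means_close.
have smL (g : V -> R) : lip L g -> lip L (smooth eps g) by exact: means_lip.
(* One [C] is spent here on replacing [phi] by its smoothing; the second one removes the smoothing
   of [u s] at the end. *)
have key t y : v t y <= smooth eps (u t) y + (C + \sum_(k <- t) eta k).
  elim: t y => [|k t IH] y.
    rewrite big_nil addr0 /=.
    by have := close phi y phiL; rewrite distrC => /(le_trans (ler_norm _)); lra.
  rewrite big_cons.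
  have h1 : transition (Y k) c (v t) y <=
      transition (Y k) c (smooth eps (u t)) y + (C + \sum_(j <- t) eta j).
    rewrite -(transition_addc _ (hY k) _ _ L0 (smL _ (uL t))).
    apply: (transition_mono _ (hY k) _ L0 L0 (vL t)) => // a b.
    by rewrite opprD addrACA subrr addr0; exact: smL.
  have h2 := YX k (u t) y (uL t).
  have h3 : transition (X k) c (smooth eps (u t)) y <= smooth eps (u (k :: t)) y.
    rewrite [u (k :: t)]/(transition (X k) c (u t)).
    exact: (transition_means c (hX k) eps _ y L0 (uL t)).
  apply: (le_trans h1); apply: (le_trans (lerD h2 (lexx _))).
  by rewrite -addrA [eta k + (C + _)]addrCA lerD2r.
have := key s x; have := close (u s) x (uL s).
by move=> /(le_trans (ler_norm _)); rewrite -/(u s x) -/(v s x); lra.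
Qed.

End Comparison.

(** * Partial sums of independent vectors as iterated transitions *)

Section Independence.
Variables (R : realType) (d : nat) (S : sublinear_space R) (X : nat -> S -> 'rV[R]_d).
Hypotheses (hX : forall i, random_vector (X i))
  (hindep : forall i, independent_from (first_vectors X i.+1) (X i.+1)).

(** Independence is applied to a test function of the pair formed by the first vectors and the last
    one; the inner expectation is then the transition. *)
Lemma Esp_partial_sum_step f (L c : R) x n : 0 <= L -> lip L f ->
  Esp (fun w : S => f (x + c *: \sum_(i < n.+1) X i w)) =
  Esp (fun w : S => transition (X n) c f (x + c *: \sum_(i < n) X i w)).
Proof.
(* [hindep] only concerns vectors with a predecessor; for [n = 0] the right-hand side is the
   expectation of a constant. *)
move=> L0 fL; case: n => [|n].
  under eq_fun do rewrite big_ord1.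
  under [in RHS]eq_fun do rewrite big_ord0 scaler0 addr0.
  by rewrite Esp_cst.
pose sumv (z : 'rV[R]_(n.+1 * d + d)) : 'rV[R]_d :=
  \sum_(i < n.+1) row i (vec_mx (lsubmx z)) + rsubmx z.
pose phi z := f (x + c *: sumv z).
have sumvE u v : sumv (row_mx u v) = \sum_(i < n.+1) row i (vec_mx u) + v.
  by rewrite /sumv row_mxKl row_mxKr.
have sumvB y z : sumv y - sumv z = sumv (y - z).
  rewrite /sumv !linearB /= opprD addrACA -sumrB; congr (_ + _).
  by apply: eq_bigr => i _; rewrite linearB.
have sumv_norm z : `|sumv z| <= n.+2%:R * `|z|.
  rewrite -[n.+2%:R]natr1 mulrDl mul1r; apply: (le_trans (ler_normD _ _)); apply: lerD.
    rewrite mulr_sum_ord; apply: (le_trans (ler_norm_sum _ _ _)); apply: ler_sum => i _.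
    by apply: norm_mx_le => // i' j; rewrite !mxE; exact: norm_mx_entry.
  by apply: norm_mx_le => // i' j; rewrite !mxE; exact: norm_mx_entry.
have phiL : C_lLip phi.
  apply: (@lip_C_lLip _ _ (L * (`|c| * n.+2%:R))) => y z.
  apply: (le_trans (fL _ _)); rewrite opprD addrACA subrr add0r -scalerBr sumvB normrZ.
  by rewrite -!mulrA !ler_wpM2l.
have firstE w : \sum_(i < n.+1) row i (vec_mx (first_vectors X n.+1 w))
    = \sum_(i < n.+1) X i w.
  by rewrite /first_vectors mxvecK; apply: eq_bigr => i _; rewrite rowK.
have := hindep phiL; rewrite /phi.
under eq_fun do rewrite sumvE firstE.
under [in RHS]eq_fun do under eq_fun do rewrite sumvE firstE scalerDr addrA.
move=> hE; under [in LHS]eq_fun do rewrite big_ord_recr /=; exact: hE.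
Qed.

Lemma Esp_partial_sum f (L c : R) x n : 0 <= L -> lip L f ->
  Esp (fun w : S => f (x + c *: \sum_(i < n) X i w)) =
  foldr (fun k => transition (X k) c) f (iota 0 n) x.
Proof.
move=> L0; elim: n f => [|n IH] f fL.
  under eq_fun do rewrite big_ord0 scaler0 addr0.
  by rewrite Esp_cst.
(* The last vector acts first on [f], so the induction runs over all [f] and the new operator sits
   at the end of the list. *)
rewrite (Esp_partial_sum_step _ _ _ L0 fL) IH; last exact: transition_lip.
by rewrite -[n.+1]addn1 iotaD foldr_cat.
Qed.

End Independence.

(** * Truncation of real numbers *)

Section Clip.
Variable R : realType.
Implicit Types N r s : R.

Definition clip N r : R := Num.max (- N) (Num.min N r).

Lemma clip_bound N r : 0 <= N -> `|clip N r| <= N.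
Proof.
move=> N0; rewrite ler_norml /clip le_max lexx ge_max ge_min lexx andbT /=.
by lra.
Qed.

Lemma clip_lip N r s : 0 <= N -> `|clip N r - clip N s| <= `|r - s|.
Proof.
move=> N0; have := ler_norm (r - s); have := ler_norm (s - r); rewrite [`|s - r|]distrC.
rewrite ler_norml /clip.
case: (leP N r) => ?; case: (leP N s) => ?; case: (leP (- N) N) => ?;
  case: (leP (- N) r) => ?; case: (leP (- N) s) => ? *; apply/andP; split; lra.
Qed.

(** The error vanishes when |r| is at most [N]; otherwise it is at most |r|, which is below
    [r ^+ 2 / N]. *)
Lemma clip_close N r : 0 < N -> `|clip N r - r| <= r ^+ 2 / N.
Proof.
move=> N0; rewrite ler_pdivlMr// /clip.
case: (leP N r) => Nr; [case: (leP (- N) N) => h1|case: (leP (- N) r) => h1].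
- by rewrite distrC ger0_norm ?subr_ge0//; nra.
- by lra.
- by rewrite subrr normr0 mul0r sqr_ge0.
- by rewrite ger0_norm; nra.
Qed.

End Clip.

(** * Semigroup property and vanishing mean of G-normal vectors *)

Section GNormal.
Variables (R : realType) (d : nat) (S : sublinear_space R) (Z : S -> 'rV[R]_d).
Hypothesis gZ : G_normal Z.
Local Notation V := 'rV[R]_d.

Lemma bounded_lip_affine (f : V -> R) x (c : R) : bounded_lip f ->
  bounded_lip (fun z => f (x + c *: z)).
Proof.
move=> [B [L [L0 fB fL]]]; exists B, (L * `|c|); split=> //.
  exact: mulr_ge0.
exact: lip_affine.
Qed.

Lemma transition_bounded_lip (f : V -> R) (c : R) : bounded_lip f -> bounded_lip (transition Z c f).
Proof.
case: gZ => hZ _ [B [L [L0 fB fL]]]; exists B, L; split=> //.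
  by move=> x; exact: (transition_bound c hZ x L0 fL fB).
exact: (transition_lip c hZ L0 fL).
Qed.

(** On the space carrying the independent copy, the outer operator is written with [Y] and the inner
    one with [Yb]; independence merges them into one expectation of [a *: Y + b *: Yb], and
    G-normality identifies its law. *)
Lemma G_normal_semigroup (f : V -> R) (a b : R) x : 0 <= a -> 0 <= b -> bounded_lip f ->
  transition Z a (transition Z b f) x = transition Z (Num.sqrt (a ^+ 2 + b ^+ 2)) f x.
Proof.
move=> a0 b0 fbL; have gbL := transition_bounded_lip b fbL.
case: (gZ) => hZ [S' [Y [Yb [hY YZ [hYb YbY ind] law]]]].
have same g c y : bounded_lip g -> Esp (fun w : S => g (y + c *: Z w))
    = Esp (fun w : S' => g (y + c *: Y w)).
  by move=> gbl; rewrite (YZ (fun z => g (y + c *: z)))//; apply/C_bLipP; exact: bounded_lip_affine.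
rewrite {1}/transition same//.
have -> : transition Z b f = fun y => Esp (fun w : S' => f (y + b *: Yb w)).
  apply/funext => y; rewrite /transition same//.
  by rewrite -(YbY (fun z => f (y + b *: z)))//; apply/C_bLipP; exact: bounded_lip_affine.
pose psi (z : 'rV[R]_(d + d)) := f (x + (a *: lsubmx z + b *: rsubmx z)).
have psiL : C_lLip psi.
  case: fbL => B [L [L0 _ fL]].
  apply: (@lip_C_lLip _ _ (L * (a + b))) => y z.
  apply: (le_trans (fL _ _)); rewrite -mulrA; apply: ler_wpM2l => //.
  rewrite opprD addrACA subrr add0r opprD addrACA -!scalerBr -!linearB /= mulrDl.
  apply: (le_trans (ler_normD _ _)); rewrite !normrZ !ger0_norm//.
  rewrite [a * _]mulrC [b * _]mulrC; apply: lerD; rewrite mulrC; apply: ler_wpM2l => //;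
    by apply: norm_mx_le => // i j; rewrite mxE; exact: norm_mx_entry.
have psiE y z : psi (row_mx y z) = f (x + (a *: y + b *: z)).
  by rewrite /psi row_mxKl row_mxKr.
have hind : Esp (fun w : S' => f (x + (a *: Y w + b *: Yb w)))
    = Esp (fun w : S' => Esp (fun w' : S' => f (x + a *: Y w + b *: Yb w'))).
  have := ind psi psiL; under eq_fun do rewrite psiE.
  by under [in RHS]eq_fun do under eq_fun do rewrite psiE addrA.
rewrite -hind (law a b a0 b0 (fun z => f (x + z)))//; apply/C_bLipP.
have := bounded_lip_affine x 1 fbL.
by under eq_fun do rewrite scale1r.
Qed.

(** Squared step sizes add up under the semigroup law. The start of [iota] is generalised in the
    induction, since the operator ignores the index. *)
Lemma G_normal_iter (f : V -> R) (c : R) n x : 0 <= c -> bounded_lip f ->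
  foldr (fun _ => transition Z c) f (iota 0 n) x
  = transition Z (c * Num.sqrt n%:R) f x.
Proof.
move=> c0 fbL.
have Z0 y : transition Z 0 f y = f y.
  rewrite /transition; under eq_fun do rewrite scale0r addr0.
  by rewrite Esp_cst.
have -> : forall m, foldr (fun _ => transition Z c) f (iota m n) =
    transition Z (c * Num.sqrt n%:R) f.
  elim: n => [|n IH] m; apply/funext => y.
    by rewrite sqrtr0 mulr0 Z0.
  rewrite /= IH G_normal_semigroup//; last by rewrite mulr_ge0 ?sqrtr_ge0.
  rewrite exprMn sqr_sqrtr// -{1}[c ^+ 2]mulr1 -mulrDr nat1r sqrtrM ?sqr_ge0//.
  by rewrite sqrtr_sqr ger0_norm.
by [].
Qed.

(* Used for [l = 1] and [l = -1].  Truncating [l * Z_j] at level [N] costs at most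
   [E[Z_j^2] / N], so the semigroup identity for [a = b = 1] passes to the unbounded
   function [l * Z_j] and gives [2 E[l * Z_j] = sqrt 2 E[l * Z_j]]. *)
Lemma G_normal_mean_zero (l : R) j : l ^+ 2 = 1 ->
  Esp (fun w : S => l * Z w 0 j) = 0.
Proof.
move=> l1; have [hZ _] := gZ.
pose q w : R := Z w 0 j ^+ 2.
have hq : Hsp q.
  by rewrite /q; under eq_fun do rewrite expr2; apply: HspM; exact: hZ.
have hl : Hsp (fun w => l * Z w 0 j) by apply: Hsp_scale; exact: hZ.
set m := Esp _; pose s := Num.sqrt (1 ^+ 2 + 1 ^+ 2 : R).
have s2 : s ^+ 2 = 2 by rewrite /s sqr_sqrtr ?addr_ge0 ?sqr_ge0// expr1n.
have s0 : 0 <= s by exact: sqrtr_ge0.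
pose C := Esp q.
have C0 : 0 <= C.
  rewrite -(Esp_cst S 0); apply: Esp_mono => //; first exact: Hsp_cst.
  by move=> w; exact: sqr_ge0.
pose t (N : R) (z : V) : R := clip N (l * z 0 j).
have tclose N z : 0 < N -> `|t N z - l * z 0 j| <= z 0 j ^+ 2 / N.
  by move=> N0; have := clip_close (l * z 0 j) N0; rewrite exprMn l1 mul1r.
have l_norm : `|l| = 1.
  by apply/eqP; rewrite -(@eqrXn2 _ 2)// ?expr1n// real_normK ?num_real// l1.
have tbl N : 0 < N -> bounded_lip (t N).
  move=> N0; exists N, 1; split=> // [z|y z]; first exact: clip_bound (ltW N0).
  apply: (le_trans (clip_lip _ _ (ltW N0))).
  rewrite -mulrBr normrM l_norm !mul1r.
  by have := norm_mx_entry (y - z) 0 j; rewrite !mxE.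
have bound N : 0 < N -> `|2 * m - s * m| <= 6 * C / N.
  move=> N0; have [B [L [L0 tB tL]]] := tbl N N0.
  have N1 : 0 <= 2 / N by rewrite divr_ge0// ltW.
  (* The factors 2 come from bounding the square of a sum by twice the sum of squares. *)
  have step x : `|transition Z 1 (t N) x - (m + l * x 0 j)| <= 2 / N * C + 2 / N * x 0 j ^+ 2.
    rewrite -[m + _](Esp_addc _ hl) -[2 / N * C](Esp_scale N1 hq).
    rewrite -[leRHS](Esp_addc _ (Hsp_scale (2 / N) hq)).
    apply: Esp_close; first exact: Hsp_transition tL.
    - by apply: Hsp_add => //; exact: Hsp_cst.
    - by apply: Hsp_add; [exact: Hsp_scale|exact: Hsp_cst].
    move=> w; have := tclose N (x + 1 *: Z w) N0.
    rewrite scale1r [l * Z w 0 j + _]addrC -mulrDr -mulrDr.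
    rewrite -[x 0 j + Z w 0 j](_ : (x + Z w) 0 j = _) ?mxE// => /le_trans; apply.
    rewrite [leRHS]mulrAC; apply: ler_wpM2r; first by rewrite invr_ge0 ltW.
    rewrite /q -subr_ge0 (_ : _ - _ = (x 0 j - Z w 0 j) ^+ 2) ?sqr_ge0//.
    by ring.
  have PL := transition_lip 1 hZ L0 tL.
  have h2 : `|transition Z 1 (transition Z 1 (t N)) 0 - (m + m)| <= 2 / N * C + 2 / N * C.
    rewrite -[m + _](Esp_addc _ hl) -{1}[2 / N * C](Esp_scale N1 hq).
    rewrite -[leRHS](Esp_addc _ (Hsp_scale (2 / N) hq)).
    apply: Esp_close; first exact: Hsp_transition PL.
    - by apply: Hsp_add => //; exact: Hsp_cst.
    - by apply: Hsp_add; [exact: Hsp_scale|exact: Hsp_cst].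
    move=> w; have := step (0 + 1 *: Z w).
    by rewrite add0r scale1r [m + _]addrC [_ * C + _]addrC.
  have h3 : `|transition Z s (t N) 0 - s * m| <= 2 / N * C.
    rewrite -[2 / N * C](Esp_scale N1 hq) -[s * m](Esp_scale s0 hl).
    apply: Esp_close; [exact: Hsp_transition tL|exact: Hsp_scale|exact: Hsp_scale|].
    move=> w; have := tclose N (0 + s *: Z w) N0.
    rewrite add0r mxE exprMn s2 mulrCA => /le_trans; apply.
    by rewrite [leRHS]mulrAC.
  (* Two unit steps cost [4 * C / N] and the single step of size [s] costs [2 * C / N], which makes
     [6 * C / N]. *)
  rewrite G_normal_semigroup// -/s in h2; last exact: tbl.
  have -> : 2 * m - s * m = (transition Z s (t N) 0 - s * m)
    - (transition Z s (t N) 0 - (m + m)) by ring.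
  apply: (le_trans (ler_normB _ _)); apply: (le_trans (lerD h3 h2)).
  by rewrite le_eqVlt; apply/orP; left; apply/eqP; ring.
have : `|2 * m - s * m| <= 0.
  apply/ler_addgt0Pr => e e0; rewrite add0r.
  have C1 : 0 < 6 * C + 1 by rewrite ltr_wpDl// mulr_ge0.
  apply: (le_trans (bound ((6 * C + 1) / e) (divr_gt0 C1 e0))).
  by rewrite invf_div mulrA ler_pdivrMr// [e * _]mulrC ler_wpM2r ?ltW// ltrDl.
rewrite normr_le0 -mulrBl mulf_eq0 => /orP[/eqP s2'|/eqP//].
have : s = 2 by lra.
by move=> ss; move: s2; rewrite ss => /eqP; rewrite expr2; lra.
Qed.

Lemma G_normal_centered j : centered (fun w : S => Z w 0 j).
Proof.
have [hZ _] := gZ; split; first exact: hZ.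
  by have := @G_normal_mean_zero 1 j (expr1n _ _); under eq_fun do rewrite mul1r.
by have := @G_normal_mean_zero (-1) j (etrans (sqrrN 1) (expr1n R 2)); under eq_fun do rewrite mulN1r.
Qed.

End GNormal.

(** * Dependence of [Gfun] on the uncertainty set *)

Section Hausdorff.
Variables (R : realType) (d : nat).
Implicit Types (D : set 'M[R]_d) (A Q : 'M[R]_d) (a e : R).

Lemma uncertainty_bounded D : uncertainty_set D -> exists2 b : R, 0 <= b & forall Q, D Q -> enorm Q <= b.
Proof.
move=> [_ [Q0 DQ0] [M [_ bM]] _ _].
have hb Q : D Q -> enorm Q <= (d * d)%:R * (M + 1).
  move=> DQ; apply: (le_trans (enorm_le_norm Q)); apply: ler_wpM2l => //.
  by apply: (bM (M + 1)) => //; rewrite ltrDl.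
exists ((d * d)%:R * (M + 1)) => //.
exact: le_trans (enorm_ge0 Q0) (hb Q0 DQ0).
Qed.

Lemma trace_close A Q Q' a : 0 <= a -> (forall i j, `|A i j| <= a) ->
  \tr (A *m Q) - \tr (A *m Q') <= d%:R ^+ 2 * a * enorm (Q - Q').
Proof.
move=> a0 Aa; rewrite -linearB /= -mulmxBr; apply: le_trans (ler_norm _) _.
rewrite /mxtrace expr2 -!mulrA mulr_sum_ord.
apply: (le_trans (ler_norm_sum _ _ _)); apply: ler_sum => i _.
rewrite mulr_sum_ord mxE; apply: (le_trans (ler_norm_sum _ _ _)); apply: ler_sum => j _.
by rewrite normrM; apply: ler_pM => //; exact: enorm_entry.
Qed.

Lemma trace_has_sup D A : uncertainty_set D -> has_sup [set \tr (A *m Q) | Q in D].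
Proof.
move=> uD; have [b b0 Db] := uncertainty_bounded uD; case: uD => _ [Q0 DQ0] _ _ _.
split; first by exists (\tr (A *m Q0)); exists Q0.
exists (d%:R ^+ 2 * enorm A * b) => _ [Q DQ <-].
have h := @trace_close A Q 0 (enorm A) (enorm_ge0 A) (enorm_entry A).
rewrite mulmx0 linear0 !subr0 in h; apply: (le_trans h); apply: ler_wpM2l; last exact: Db.
by rewrite mulr_ge0 ?enorm_ge0 ?sqr_ge0.
Qed.

Lemma dist_set_lt_exists D Q e : D !=set0 -> dist_set Q D < e ->
  exists2 Q', D Q' & enorm (Q - Q') < e.
Proof.
move=> [Q0 DQ0] lt_e.
have [|_ [Q' DQ' <-] h] := @inf_lt _ [set enorm (Q - y) | y in D] e _ lt_e.
  by exists (enorm (Q - Q0)); exists Q0.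
by exists Q'.
Qed.

(** Every [Q] in [D] has a partner in [D'] at distance below [e], and their traces against [A]
    differ by at most [d%:R ^+ 2 * a * e]. *)
Lemma Gfun_le_nbhd D D' A a e : uncertainty_set D -> uncertainty_set D' ->
  0 <= a -> (forall i j, `|A i j| <= a) -> D `<=` nbhd_set e D' ->
  Gfun D A <= Gfun D' A + 2^-1 * (d%:R ^+ 2 * a * e).
Proof.
move=> uD uD' a0 Aa sub; rewrite /Gfun -mulrDr ler_pM2l ?invr_gt0//.
have [nD bD] := trace_has_sup A uD; have [nD' bD'] := trace_has_sup A uD'.
apply: ge_sup => // _ [Q DQ <-].
have [_ h] := sub _ DQ; case: uD' => _ D'0 _ _ _.
have [Q' DQ' QQ'] := dist_set_lt_exists D'0 h.
have tq' : \tr (A *m Q') <= sup [set \tr (A *m Q) | Q in D'].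
  by apply: (ub_le_sup bD'); exists Q'.
have tqq := trace_close Q Q' a0 Aa.
have : d%:R ^+ 2 * a * enorm (Q - Q') <= d%:R ^+ 2 * a * e.
  by apply: ler_wpM2l (ltW QQ'); rewrite mulr_ge0 ?sqr_ge0.
lra.
Qed.

Lemma sub_nbhd_exists D D' : uncertainty_set D -> uncertainty_set D' ->
  exists2 e : R, 0 < e & D `<=` nbhd_set e D'.
Proof.
move=> uD uD'; have [b b0 Db] := uncertainty_bounded uD.
case: uD' => _ [Q0 DQ0] _ _ _; case: uD => psdD _ _ _ _.
exists ((d * d)%:R * (b + enorm Q0) + 1).
  by rewrite ltr_wpDl// mulr_ge0// addr_ge0// enorm_ge0.
move=> Q DQ; split; first exact: psdD.
apply: (@le_lt_trans _ _ ((d * d)%:R * (b + enorm Q0))); last by rewrite ltrDl.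
apply: (@le_trans _ _ (enorm (Q - Q0))).
  apply: ge_inf; last by exists Q0.
  by exists 0 => _ [y _ <-]; exact: enorm_ge0.
apply: (le_trans (enorm_le_norm _)); apply: ler_wpM2l => //.
apply: (le_trans (ler_normB _ _)); apply: lerD; last exact: norm_le_enorm.
exact: le_trans (norm_le_enorm _) (Db _ DQ).
Qed.

(** The infimum of an empty set is 0 by default, so admissible radii must be exhibited before
    [hausdorff_dist] can bound anything. *)
Lemma hausdorff_set_nonempty D D' : uncertainty_set D -> uncertainty_set D' ->
  exists e : R, 0 < e /\ (D `<=` nbhd_set e D' /\ D' `<=` nbhd_set e D).
Proof.
move=> uD uD'; have [e1 e10 s1] := sub_nbhd_exists uD uD'.
have [e2 e20 s2] := sub_nbhd_exists uD' uD.
exists (e1 + e2); split; first exact: addr_gt0.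
split.
- by move=> Q /s1 [? h]; split=> //; apply: (lt_trans h); rewrite ltrDl.
- by move=> Q /s2 [? h]; split=> //; apply: (lt_trans h); rewrite ltrDr.
Qed.

Lemma Gfun_hausdorff D D' A a : uncertainty_set D -> uncertainty_set D' ->
  0 <= a -> (forall i j, `|A i j| <= a) ->
  `|Gfun D A - Gfun D' A| <= 2^-1 * (d%:R ^+ 2 * a) * hausdorff_dist D D'.
Proof.
move=> uD uD' a0 Aa; set k := 2^-1 * _.
have k0 : 0 <= k by rewrite mulr_ge0 ?invr_ge0 ?mulr_ge0 ?sqr_ge0.
have all_e e : 0 < e /\ (D `<=` nbhd_set e D' /\ D' `<=` nbhd_set e D) ->
    `|Gfun D A - Gfun D' A| <= k * e.
  move=> [e0 [s1 s2]]; have := Gfun_le_nbhd uD uD' a0 Aa s1.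
  have := Gfun_le_nbhd uD' uD a0 Aa s2.
  by rewrite ler_norml /k -mulrA => *; apply/andP; split; lra.
have [e he] := hausdorff_set_nonempty uD uD'.
(* Passing to the infimum divides by [k]; when [k] is 0, any admissible radius gives the bound. *)
have [k00|k_neq0] := eqVneq k 0.
  by have := all_e e he; rewrite k00 !mul0r.
have kp : 0 < k by rewrite lt_def k_neq0.
rewrite mulrC -ler_pdivrMr//; apply: lb_le_inf; first by exists e.
by move=> e' he'; rewrite ler_pdivrMr// mulrC; exact: all_e.
Qed.

End Hausdorff.

(** * One-step error between two transitions *)

Section OneStep.
Variables (R : realType) (d : nat).
Local Notation V := 'rV[R]_d.

(** Both transitions are expanded at the same point with the same [A]. The values at [x] cancel,
    leaving the difference of the two [Gfun] at [A] and two cubic remainders. *)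
Lemma transition_smooth_close (S1 S2 : sublinear_space R) (X : S1 -> V) (Y : S2 -> V)
    (D1 D2 : set 'M[R]_d) (c L eps : R) (f : V -> R) x :
  random_vector X -> random_vector Y ->
  (forall j, centered (fun w => X w 0 j)) -> (forall j, centered (fun w => Y w 0 j)) ->
  uncertainty_set D1 -> uncertainty_set D2 ->
  (forall A, symmetric_mx A -> 2^-1 * Esp (fun w : S1 => qform A (X w)) = Gfun D1 A) ->
  (forall A, symmetric_mx A -> 2^-1 * Esp (fun w : S2 => qform A (Y w)) = Gfun D2 A) ->
  0 <= L -> 0 < eps -> 0 <= c -> lip L f ->
  `|transition X c (smooth eps f) x - transition Y c (smooth eps f) x| <=
    c ^+ 2 * (2^-1 * (d%:R ^+ 2 * (2 * (d%:R ^+ 2 * (2 * L / eps)))) * hausdorff_dist D1 D2)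
    + c ^+ 3 * (2 * (2 * L / eps) / eps * d%:R ^+ 3
       * (Esp (fun w : S1 => enorm (X w) ^+ 3) + Esp (fun w : S2 => enorm (Y w) ^+ 3))).
Proof.
move=> hX hY cX cY uD1 uD2 G1 G2 L0 e0 c0 fL.
have [p [A [sA Ab tay]]] := smooth_taylor x e0 L0 fL.
have sL : lip L (smooth eps f) by exact: means_lip.
set K := 2 * (2 * L / eps) / eps * d%:R ^+ 3 in tay *.
have L1 : 0 <= 2 * L / eps by rewrite divr_ge0 ?mulr_ge0// ltW.
have K0 : 0 <= K.
  by rewrite mulr_ge0 ?exprn_ge0// divr_ge0 ?(ltW e0)// mulr_ge0.
have tX := transition_taylor c hX L0 sL K0 cX tay.
have tY := transition_taylor c hY L0 sL K0 cY tay.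
rewrite G1// (ger0_norm c0) in tX; rewrite G2// (ger0_norm c0) in tY.
have a0 : 0 <= 2 * (d%:R ^+ 2 * (2 * L / eps)) :> R.
  by rewrite mulr_ge0// mulr_ge0// sqr_ge0.
have hD := ler_wpM2l (sqr_ge0 c) (Gfun_hausdorff uD1 uD2 a0 Ab).
rewrite -{1}(ger0_norm (sqr_ge0 c)) -normrM in hD.
set TX := transition X c _ x in tX *; set TY := transition Y c _ x in tY *.
have -> : TX - TY = c ^+ 2 * (Gfun D1 A - Gfun D2 A)
  + ((TX - smooth eps f x - c ^+ 2 * Gfun D1 A)
     - (TY - smooth eps f x - c ^+ 2 * Gfun D2 A)) by ring.
apply: (le_trans (ler_normD _ _)); apply: (lerD hD).
apply: (le_trans (ler_normB _ _)); apply: (le_trans (lerD tX tY)).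
by rewrite le_eqVlt; apply/orP; left; apply/eqP; ring.
Qed.

End OneStep.

(** * Convergence in law by summing the one-step errors *)

Theorem corollary3p4 (R : realType) (d : nat) (S : sublinear_space R)
    (X : nat -> S -> 'rV[R]_d) (M : R)
    (Theta : set 'M[R]_d) (Thetas : nat -> set 'M[R]_d)
    (hX : forall i, random_vector (X i))
    (hindep : forall i, independent_from (first_vectors X i.+1) (X i.+1))
    (hmean : forall i (j : 'I_d),
       Esp (fun w : S => X i w 0 j) = 0 /\ Esp (fun w : S => - X i w 0 j) = 0)
    (hM : 0 < M)
    (hmoment : forall i, Esp (fun w : S => enorm (X i w) ^+ 3) <= M)
    (hTheta : uncertainty_set Theta)
    (hThetas : forall i, uncertainty_set (Thetas i))
    (hG : forall i (A : 'M[R]_d), symmetric_mx A ->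
       2^-1 * Esp (fun w : S => qform A (X i w)) = Gfun (Thetas i) A)
    (hdist : (fun n : nat =>
       n%:R^-1 * \sum_(i < n) hausdorff_dist Theta (Thetas i)) @ \oo --> (0 : R)) :
  forall (S' : sublinear_space R) (Z : S' -> 'rV[R]_d),
    G_normal_law Theta Z ->
    forall phi : 'rV[R]_d -> R, C_bLip phi ->
      (fun n : nat =>
         Esp (fun w : S => phi ((Num.sqrt n%:R)^-1 *: \sum_(i < n) X i w))) @ \oo
        --> Esp (fun w : S' => phi (Z w)).
Proof.
move=> S' Z [gZ GZ] phi /C_bLipP phi_bl; have [hZ _] := gZ.
have [B [L [L0 phiB phiL]]] := phi_bl.
have cX i j : centered (fun w => X i w 0 j).
  by have [m1 m2] := hmean i j; split=> //; exact: hX.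
have cZ := G_normal_centered gZ.
have GZ' A : symmetric_mx A -> 2^-1 * Esp (fun w : S' => qform A (Z w)) = Gfun Theta A.
  move=> sA; rewrite -GZ// Esp_scale ?invr_ge0//; exact: Hsp_qform.
pose m3 := Esp (fun w : S' => enorm (Z w) ^+ 3).
pose C1 eps : R := 2^-1 * (d%:R ^+ 2 * (2 * (d%:R ^+ 2 * (2 * L / eps)))).
pose C2 eps : R := 2 * (2 * L / eps) / eps * d%:R ^+ 3 * (M + m3).
pose N2 : R := (size (enum 'I_d ++ enum 'I_d))%:R.
(* Bound at fixed [n] and [eps]: the cost of smoothing, the averaged Hausdorff distances and the
   third moments. *)
have main n eps : 0 < eps ->
  `|Esp (fun w : S' => phi (Z w))
    - Esp (fun w : S => phi ((Num.sqrt n.+1%:R)^-1 *: \sum_(i < n.+1) X i w))| <=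
  2 * (N2 * (L * eps))
  + C1 eps * (n.+1%:R^-1 * \sum_(i < n.+1) hausdorff_dist Theta (Thetas i))
  + C2 eps * (Num.sqrt n.+1%:R)^-1.
  move=> e0; set c := (Num.sqrt _)^-1.
  have sq0 : 0 < Num.sqrt (n.+1%:R : R) by rewrite sqrtr_gt0.
  have c0 : 0 <= c by rewrite invr_ge0 ltW.
  have c2 : c ^+ 2 = n.+1%:R^-1 by rewrite exprVn sqr_sqrtr.
  have EX : Esp (fun w : S => phi (c *: \sum_(i < n.+1) X i w)) =
      foldr (fun k => transition (X k) c) phi (iota 0 n.+1) 0.
    rewrite -(Esp_partial_sum hX hindep _ _ _ L0 phiL).
    by congr Esp; apply/funext => w; rewrite add0r.
  have EZ : Esp (fun w : S' => phi (Z w)) =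
      foldr (fun=> transition Z c) phi (iota 0 n.+1) 0.
    rewrite (G_normal_iter gZ _ _ c0 phi_bl) mulVf ?gt_eqF// /transition.
    by congr Esp; apply/funext => w; rewrite add0r scale1r.
  (* Over [n.+1] steps, [c ^+ 2 = n.+1%:R^-1] produces the averaged distances, while the cubic terms
     sum to [C2 eps * c]. *)
  pose eta k : R := c ^+ 2 * (C1 eps * hausdorff_dist Theta (Thetas k)) + c ^+ 3 * C2 eps.
  have sumE : \sum_(k <- iota 0 n.+1) eta k =
      C1 eps * (n.+1%:R^-1 * \sum_(i < n.+1) hausdorff_dist Theta (Thetas i))
      + C2 eps * c.
    rewrite -[iota 0 n.+1]/(index_iota 0 n.+1) big_mkord big_split /= sumr_const card_ord.
    rewrite -mulr_sumr -mulr_sumr c2 mulrCA -mulr_natl; congr (_ + _).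
    by rewrite exprS c2; field; rewrite ?gt_eqF ?ltr0Sn.
  have close k (g : 'rV[R]_d -> R) y : lip L g ->
      `|transition Z c (smooth eps g) y - transition (X k) c (smooth eps g) y| <= eta k.
    move=> gL.
    have := transition_smooth_close y hZ (hX k) cZ (cX k) hTheta (hThetas k)
      GZ' (hG k) L0 e0 c0 gL.
    move=> /le_trans; apply; rewrite /eta lerD2l; apply: ler_wpM2l; first exact: exprn_ge0.
    rewrite /C2; apply: ler_wpM2l; last by rewrite addrC lerD2r.
    by rewrite mulr_ge0 ?exprn_ge0// !(divr_ge0, mulr_ge0)// ltW.
  (* The two signs are the two orders in which the chains can be compared. *)
  rewrite EX EZ -addrA -sumE ler_norml; apply/andP; split.
    have := @chain_comparison R d S' S (fun=> Z) X c (fun=> hZ) hX phi L eps eta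
      (iota 0 n.+1) 0 L0 (ltW e0) phiL.
    rewrite -/N2 => h; rewrite lerNl opprB lerBlDl addrA; apply: h => k g y gL.
    by have := close k g y gL; rewrite distrC => /(le_trans (ler_norm _)); rewrite lerBlDl.
  have := @chain_comparison R d S S' X (fun=> Z) c hX (fun=> hZ) phi L eps eta
    (iota 0 n.+1) 0 L0 (ltW e0) phiL.
  rewrite -/N2 => h; rewrite lerBlDl addrA; apply: h => k g y gL.
  by have := close k g y gL => /(le_trans (ler_norm _)); rewrite lerBlDl.
(* Index 0, where the inverse of the square root is 0 by default, is dropped. *)
rewrite -cvg_shiftS; apply/cvgrPdist_le => e e0.
have e3 : 0 < e / 3 by rewrite divr_gt0.
have K1 : 0 < 2 * (N2 * L) + 1 by rewrite ltr_wpDl// !mulr_ge0.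
(* [eps] is fixed first, making the smoothing cost at most [e / 3]; the constants [C1 eps] and
   [C2 eps] are then frozen while [n] grows. Adding 1 keeps the denominator positive. *)
pose eps := e / 3 / (2 * (N2 * L) + 1).
have eps0 : 0 < eps by rewrite divr_gt0.
have h1 : 2 * (N2 * (L * eps)) <= e / 3.
  rewrite (_ : 2 * _ = (2 * (N2 * L)) * eps); last by ring.
  have -> : e / 3 = (2 * (N2 * L) + 1) * eps by rewrite /eps [RHS]mulrC divfK ?gt_eqF.
  by apply: ler_wpM2r (ltW eps0) _ _ _; rewrite lerDl.
have lim1 : (fun n : nat => C1 eps * (n.+1%:R^-1 *
    \sum_(i < n.+1) hausdorff_dist Theta (Thetas i))) @ \oo --> (0 : R).
  rewrite -[X in _ --> X](mulr0 (C1 eps)); apply: cvgMl_tmp.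
  have := hdist; rewrite -cvg_shiftS => h. exact: h.
have lim2 : (fun n : nat => C2 eps * (Num.sqrt n.+1%:R)^-1) @ \oo --> (0 : R).
  rewrite -[X in _ --> X](mulr0 (C2 eps)); apply: cvgMl_tmp.
  rewrite (_ : (fun n : nat => _) = fun n => Num.sqrt (@harmonic R n)); last first.
    by apply/funext => n; rewrite /= sqrtrV.
  rewrite -[X in _ --> X]sqrtr0.
  by apply: (cvg_comp _ _ cvg_harmonic); exact: sqrt_continuous.
near=> n; apply: (le_trans (main n eps eps0)).
have q1 : C1 eps * (n.+1%:R^-1 * \sum_(i < n.+1) hausdorff_dist Theta (Thetas i)) <= e / 3.
  near: n; move/cvgrPdist_le : lim1 => /(_ _ e3); apply: filterS => n.
  by rewrite sub0r normrN => /(le_trans (ler_norm _)).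
have q2 : C2 eps * (Num.sqrt n.+1%:R)^-1 <= e / 3.
  near: n; move/cvgrPdist_le : lim2 => /(_ _ e3); apply: filterS => n.
  by rewrite sub0r normrN => /(le_trans (ler_norm _)).
apply: (le_trans (lerD (lerD h1 q1) q2)); lra.
Unshelve. all: by end_near.
Qed.
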